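(* Let $G$ be a duality group which is not infinite cyclic, and let $H$ be a finitely generated solvable group. Assume that $G \curvearrowright X$ is a topologically free system on a compact space $X$ such that $G \curvearrowright X$ is almost $\mathbb{Z}G$-projective. Furthermore, let $H \curvearrowright Y$ be a topologically free system. If $G \curvearrowright X$ and $H \curvearrowright Y$ are continuously orbit equivalent, then they are conjugate.
   Context: All groups are discrete and countable; all topological spaces are locally compact and Hausdorff. A (topological dynamical) system $G \curvearrowright X$ is an action $(g,x) \mapsto g.x$ of a group $G$ on a space $X$ by homeomorphisms. It is topologically free if for every $e \neq g \in G$ the set $\{x \in X : g.x \neq x\}$ is dense in $X$. A group $G$ is called a duality group (as in Brown's book ''Cohomology of groups'') if $G$ is of type FP (i.e., the trivial module $\mathbb{Z}$ has a finite-length resolution by finitely generated projective $\mathbb{Z}G$-modules) and there is an integer $n$ such that $H^i(G,\mathbb{Z}G) = 0$ for all $i \neq n$ and $H^n(G,\mathbb{Z}G)$ is torsion-free as an abelian group (then $n$ is the cohomological dimension of $G$). A system $G \curvearrowright X$ with $X$ compact is almost $\mathbb{Z}G$-projective if $C(X,\mathbb{Z}) \cong \mathbb{Z} \oplus P$ as $\mathbb{Z}G$-modules, where the copy of $\mathbb{Z}$ is given by the constant functions on $X$ and $P$ is a projective $\mathbb{Z}G$-module. Here $G$ acts on $C(X,\mathbb{Z})$ by $(g.f)(x) = f(g^{-1}.x)$. $G \curvearrowright X$ and $H \curvearrowright Y$ are continuously orbit equivalent if there exist a homeomorphism $\varphi: X \to Y$ with inverse $\psi$ and continuous maps $a: G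 \times X \to H$, $b: H \times Y \to G$ (with $G$, $H$ discrete) such that $\varphi(g.x) = a(g,x).\varphi(x)$ and $\psi(h.y) = b(h,y).\psi(y)$ for all $g,x,h,y$. They are conjugate if there are a homeomorphism $\varphi: X \to Y$ and a group isomorphism $\rho: G \to H$ with $\varphi(g.x) = \rho(g).\varphi(x)$ for all $g \in G$, $x \in X$. *)

(* Defs.v *)
From HB Require Import structures.
From mathcomp Require Import all_boot all_order all_algebra finmap.
From mathcomp Require Import all_classical topology.

Set Implicit Arguments.
Unset Strict Implicit.
Unset Printing Implicit Defensive.

Import GRing.Theory.
Local Open Scope classical_set_scope.
Local Open Scope ring_scope.

Section Groups.
Context {G : groupType}.
Local Open Scope group_scope.

Definition is_subgroup (A : set G) : Prop :=
  A 1 /\ forall x y, A x -> A y -> A (x * y^-1).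

Definition generated (S : set G) : set G := smallest is_subgroup S.

Fixpoint derived_series (n : nat) : set G :=
  if n is m.+1 then
    generated [set z | exists x y, [/\ derived_series m x,
                                       derived_series m y & z = [~ x, y]]]
  else [set: G].

End Groups.

Definition solvable_group (G : groupType) : Prop :=
  exists n, derived_series n = [set 1%g : G].

Definition finitely_generated_group (G : groupType) : Prop :=
  exists s : seq G, generated [set` s] = [set: G].

Definition infinite_cyclic (G : groupType) : Prop :=
  infinite_set [set: G] /\ exists g : G, generated [set g] = [set: G].

Definition group_ring (G : groupType) : Type := {fsfun G -> int with 0}.

Section GroupRing.
Context (G : groupType).
Implicit Types (a b c : group_ring G) (g h : G).

HB.instance Definition _ := Choice.copy (group_ring G) {fsfun G -> int with 0}.

Let coef a : G -> int := fun_of_fsfun a.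

Let grP a b : (forall g, coef a g = coef b g) -> a = b.
Proof. by move=> e; apply/fsfunP. Qed.

Definition gr_zero : group_ring G := [fsfun].
Definition gr_opp a : group_ring G := [fsfun g in finsupp a => - a g].
Definition gr_add a b : group_ring G :=
  [fsfun g in (finsupp a `|` finsupp b)%fset => a g + b g].

Let gr_zeroE g : coef gr_zero g = 0.
Proof. by rewrite /coef fsfunE. Qed.

Let gr_oppE a g : coef (gr_opp a) g = - coef a g.
Proof. by rewrite /coef fsfunE; case: finsuppP => // _; rewrite oppr0. Qed.

Let gr_addE a b g : coef (gr_add a b) g = coef a g + coef b g.
Proof.
rewrite /coef fsfunE in_fsetU.
by case: (finsuppP a); case: (finsuppP b); rewrite ?addr0.
Qed.

Fact gr_addA : associative gr_add.
Proof. by move=> a b c; apply: grP => g; rewrite !gr_addE addrA. Qed.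
Fact gr_addC : commutative gr_add.
Proof. by move=> a b; apply: grP => g; rewrite !gr_addE addrC. Qed.
Fact gr_add0 : left_id gr_zero gr_add.
Proof. by move=> a; apply: grP => g; rewrite !gr_addE gr_zeroE add0r. Qed.
Fact gr_addN : left_inverse gr_zero gr_opp gr_add.
Proof.
by move=> a; apply: grP => g; rewrite !gr_addE gr_zeroE gr_oppE addNr.
Qed.

HB.instance Definition _ := GRing.isZmodule.Build (group_ring G)
  gr_addA gr_addC gr_add0 gr_addN.

Definition gr_elt g : group_ring G := [fsfun h in [fset g]%fset => 1].

Lemma gr_coefD a b g : (a + b) g = a g + b g.
Proof. exact: gr_addE. Qed.

Lemma gr_coef0 g : (0 : group_ring G) g = 0.
Proof. exact: gr_zeroE. Qed.

Lemma gr_eltE g h : gr_elt g h = (h == g)%:R.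
Proof. by rewrite fsfunE in_fset1; case: eqP. Qed.

(* sum_g a_g F(g), the additive extension of F along gr_elt. *)
Definition gr_lift (M : zmodType) (F : G -> M) a : M :=
  \sum_(g <- finsupp a) F g *~ a g.

Section Lift.
Context (M : zmodType).
Implicit Type F : G -> M.

Lemma gr_lift_wide (D : {fset G}) F a : (finsupp a `<=` D)%fset ->
  gr_lift F a = \sum_(g <- D) F g *~ a g.
Proof.
move=> sD; apply: big_fset_incl => // g _ /fsfun_dflt ->.
by rewrite mulr0z.
Qed.

Lemma gr_liftD F a b : gr_lift F (a + b) = gr_lift F a + gr_lift F b.
Proof.
pose D := (finsupp a `|` finsupp b `|` finsupp (a + b)%R)%fset.
have sa : (finsupp a `<=` D)%fset by rewrite /D -fsetUA fsubsetUl.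
have sb : (finsupp b `<=` D)%fset.
  by rewrite /D [(finsupp a `|` _)%fset]fsetUC -fsetUA fsubsetUl.
have sab : (finsupp (a + b)%R `<=` D)%fset by rewrite /D fsubsetUr.
rewrite (gr_lift_wide _ sa) (gr_lift_wide _ sb) (gr_lift_wide _ sab).
by rewrite -big_split; apply: eq_bigr => g _; rewrite gr_coefD mulrzDr.
Qed.

Lemma gr_lift0 F : gr_lift F 0 = 0.
Proof. by apply: (addrI (gr_lift F 0)); rewrite -gr_liftD !addr0. Qed.

Lemma gr_lift_elt F g : gr_lift F (gr_elt g) = F g.
Proof.
rewrite (@gr_lift_wide [fset g]%fset) ?big_seq_fset1 ?gr_eltE ?eqxx //.
apply/fsubsetP => h; rewrite mem_finsupp gr_eltE in_fset1.
by case: (h == g).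
Qed.

Lemma eq_gr_lift F F' a : F =1 F' -> gr_lift F a = gr_lift F' a.
Proof. by move=> e; apply: eq_bigr => g _; rewrite e. Qed.

Lemma gr_liftDF F F' a :
  gr_lift (fun g => F g + F' g) a = gr_lift F a + gr_lift F' a.
Proof. by rewrite -big_split; apply: eq_bigr => g _; rewrite mulrzDl. Qed.

End Lift.

Lemma gr_lift_morph (M N : zmodType) (f : M -> N) (F : G -> M) a :
  {morph f : x y / x + y} -> f (gr_lift F a) = gr_lift (f \o F) a.
Proof.
move=> fD.
have f0 : f 0 = 0 by apply: (addrI (f 0)); rewrite -fD !addr0.
have fN x : f (- x) = - f x.
  by apply: (addrI (f x)); rewrite -fD !subrr f0.
have fMn x n : f (x *+ n) = f x *+ n.
  by elim: n => [|n IH]; rewrite ?mulr0n // !mulrS fD IH.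
have fMz x (k : int) : f (x *~ k) = f x *~ k.
  by case: k => n; rewrite ?NegzE ?mulrNz ?fN -!pmulrn fMn.
rewrite /gr_lift (big_morph f fD f0); apply: eq_bigr => g _.
by rewrite fMz.
Qed.

Lemma gr_lift_id a : gr_lift gr_elt a = a.
Proof.
apply: grP => g.
have cD : {morph (fun b : group_ring G => coef b g) : x y / x + y}.
  by move=> x y; rewrite /coef gr_coefD.
rewrite (gr_lift_morph gr_elt a cD) /gr_lift.
rewrite (eq_bigr (fun h => a h *+ (h == g))); last first.
  move=> h _; rewrite /= /coef gr_eltE eq_sym.
  by case: (h == g); rewrite ?mulr1n ?mulr0n ?mul0rz // intz.
rewrite [RHS]/coef; case: (finsuppP a g) => ga.
  by rewrite big_seq big1 // => h ha; case: eqP ha ga => // -> ->.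
rewrite (big_fsetD1 g) //= eqxx mulr1n big_seq big1 ?addr0 // => h.
by rewrite in_fsetD1 => /andP[/negbTE ->].
Qed.

Definition gr_one : group_ring G := gr_elt 1%g.

(* The product sum_(g, h) (a g * b h) [gh]. *)
Definition gr_mul a b : group_ring G :=
  gr_lift (fun g => gr_lift (fun h => gr_elt (g * h)%g) b) a.

Fact gr_lift_mul (M : zmodType) (F : G -> M) a b :
  gr_lift F (gr_mul a b) = gr_lift (fun g => gr_lift (fun h => F (g * h)%g) b) a.
Proof.
rewrite (gr_lift_morph _ _ (gr_liftD F)); apply: eq_gr_lift => g /=.
rewrite (gr_lift_morph _ _ (gr_liftD F)); apply: eq_gr_lift => h /=.
by rewrite gr_lift_elt.
Qed.

Fact gr_mulDl : left_distributive gr_mul +%R.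
Proof. by move=> a b c; exact: gr_liftD. Qed.

Fact gr_mulDr : right_distributive gr_mul +%R.
Proof.
move=> a b c; rewrite -gr_liftDF; apply: eq_gr_lift => g.
exact: gr_liftD.
Qed.

Fact gr_mulA : associative gr_mul.
Proof.
move=> a b c; rewrite {3}/gr_mul gr_lift_mul; apply: eq_gr_lift => g.
rewrite gr_lift_mul; apply: eq_gr_lift => h; apply: eq_gr_lift => k.
by rewrite mulgA.
Qed.

Fact gr_mul1l : left_id gr_one gr_mul.
Proof.
move=> a; rewrite /gr_mul gr_lift_elt -[RHS]gr_lift_id.
by apply: eq_gr_lift => g; rewrite mul1g.
Qed.

Fact gr_mul1r : right_id gr_one gr_mul.
Proof.
move=> a; rewrite -[RHS]gr_lift_id; apply: eq_gr_lift => g.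
by rewrite gr_lift_elt mulg1.
Qed.

Fact gr_one_neq0 : gr_one != 0.
Proof.
apply/eqP => /(congr1 (fun a => coef a 1%g)).
by rewrite /coef gr_eltE gr_coef0 eqxx.
Qed.

HB.instance Definition _ := GRing.Zmodule_isNzRing.Build (group_ring G)
  gr_mulA gr_mul1l gr_mul1r gr_mulDl gr_mulDr gr_one_neq0.

End GroupRing.

Record group_action (G : groupType) (M : zmodType) := GroupAction {
  gact :> G -> M -> M;
  gact1 : forall m, gact 1%g m = m;
  gactM : forall g h m, gact (g * h)%g m = gact g (gact h m);
  gactD : forall g, {morph gact g : m n / m + n}
}.

Definition gmodule (G : groupType) (M : zmodType) (act : group_action G M)
  : Type := M.

Section GModule.
Context (G : groupType) (M : zmodType) (act : group_action G M).

HB.instance Definition _ := GRing.Zmodule.copy (gmodule act) M.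

Definition gm_scale (a : group_ring G) (m : gmodule act) : gmodule act :=
  gr_lift (fun g => act g m) a.

Fact gm_scaleA (a b : group_ring G) m :
  gm_scale a (gm_scale b m) = gm_scale (a * b) m.
Proof.
rewrite /gm_scale gr_lift_mul; apply: eq_gr_lift => g.
rewrite (gr_lift_morph _ _ (@gactD _ _ act g)); apply: eq_gr_lift => h /=.
by rewrite gactM.
Qed.

Fact gm_scale1 : left_id 1 gm_scale.
Proof. by move=> m; rewrite /gm_scale gr_lift_elt gact1. Qed.

Fact gm_scaleDr : right_distributive gm_scale +%R.
Proof.
move=> a m n; rewrite /gm_scale -gr_liftDF; apply: eq_gr_lift => g.
exact: (@gactD _ _ act g m n).
Qed.

Fact gm_scaleDl (m : gmodule act) : {morph gm_scale^~ m : a b / a + b}.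
Proof. by move=> a b; exact: gr_liftD. Qed.

HB.instance Definition _ := GRing.Zmodule_isLmodule.Build (group_ring G)
  (gmodule act) gm_scaleA gm_scale1 gm_scaleDr gm_scaleDl.

End GModule.

Definition trivial_action (G : groupType) : group_action G int :=
  @GroupAction G int (fun _ k => k) (fun _ => erefl) (fun _ _ _ => erefl)
    (fun _ _ _ => erefl).

Definition trivial_int (G : groupType) : lmodType (group_ring G) :=
  gmodule (trivial_action G).

Definition projective (R : pzRingType) (P : lmodType R) : Prop :=
  forall (M N : lmodType R) (p : {linear M -> N}) (f : {linear P -> N}),
    (forall y, exists x, p x = y) ->
    exists h : {linear P -> M}, forall x, p (h x) = f x.

Definition finitely_generated_module (R : pzRingType) (M : lmodType R) : Prop :=
  exists s : seq M, forall x : M, exists c : 'I_(size s) -> R,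
    x = \sum_(i < size s) c i *: s`_i.

(* A finite resolution 0 -> P n -> ... -> P 0 -> Z -> 0 is encoded as an
   infinite one whose terms of index greater than n vanish. *)
Definition type_FP (G : groupType) : Prop :=
  exists (n : nat) (P : nat -> lmodType (group_ring G))
         (d : forall i, {linear P i.+1 -> P i})
         (eps : {linear P 0%N -> trivial_int G}),
    [/\ forall i, projective (P i) /\ finitely_generated_module (P i),
        forall i (x : P i), (n < i)%N -> x = 0,
        forall k, exists x, eps x = k,
        forall x, eps x = 0 <-> exists y, d 0%N y = x &
        forall i x, d i x = 0 <-> exists y, d i.+1 y = x].

(* The cohomology H^n(G, M) is that of Hom_G(F, M), for F the standard
   resolution of Z: F_n is the free abelian group on the (n+1)-tuples in G, with the
   diagonal action, and the boundary is the alternating sum of the faces. *)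
Section Cohomology.
Context (G : groupType) (M : lmodType (group_ring G)).

Definition is_cochain (n : nat) (f : {ffun 'I_n.+1 -> G} -> M) : Prop :=
  forall (h : G) (g : {ffun 'I_n.+1 -> G}),
    f [ffun j => (h * g j)%g] = gr_elt h *: f g.

Definition cobd (n : nat) (f : {ffun 'I_n.+1 -> G} -> M)
    (g : {ffun 'I_n.+2 -> G}) : M :=
  \sum_(i < n.+2) (-1) ^+ i *: f [ffun j => g (lift i j)].

Definition is_cocycle (n : nat) (f : {ffun 'I_n.+1 -> G} -> M) : Prop :=
  is_cochain f /\ forall g, cobd f g = 0.

Definition is_coboundary (n : nat) : ({ffun 'I_n.+1 -> G} -> M) -> Prop :=
  match n with
  | 0%N => fun f => forall g, f g = 0
  | m.+1 => fun f => exists c : {ffun 'I_m.+1 -> G} -> M,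
      is_cochain c /\ forall g, f g = cobd c g
  end.

Definition cohomology_trivial (n : nat) : Prop :=
  forall f : {ffun 'I_n.+1 -> G} -> M, is_cocycle f -> is_coboundary f.

Definition cohomology_torsion_free (n : nat) : Prop :=
  forall (f : {ffun 'I_n.+1 -> G} -> M) (k : nat), is_cocycle f -> (0 < k)%N ->
    is_coboundary (fun g => f g *+ k) -> is_coboundary f.

End Cohomology.

(* A negative n, for which all cohomology vanishes, also satisfies this with
   n = 0, so n ranges over nat. *)
Definition duality_group (G : groupType) : Prop :=
  type_FP G /\
  exists n : nat,
    (forall i : nat, i <> n -> cohomology_trivial (group_ring G)^o i) /\
    cohomology_torsion_free (group_ring G)^o n.

(* Each act g is a homeomorphism, with inverse act g^-1. *)
Record dynsys (G : groupType) (X : topologicalType) := DynSys {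
  act :> G -> X -> X;
  act1 : forall x, act 1%g x = x;
  actM : forall g h x, act (g * h)%g x = act g (act h x);
  act_cts : forall g, continuous (act g)
}.

Definition topologically_free (G : groupType) (X : topologicalType)
    (S : dynsys G X) : Prop :=
  forall g : G, g <> 1%g -> dense [set x | S g x <> x].

Definition homeo_pair (X Y : topologicalType) (phi : X -> Y) (psi : Y -> X)
    : Prop :=
  [/\ continuous phi, continuous psi, cancel phi psi & cancel psi phi].

Definition continuously_orbit_equivalent (G H : groupType)
    (X Y : topologicalType) (S : dynsys G X) (T : dynsys H Y) : Prop :=
  exists (phi : X -> Y) (psi : Y -> X)
         (a : discrete_topology G * X -> discrete_topology H)
         (b : discrete_topology H * Y -> discrete_topology G),
    [/\ homeo_pair phi psi, continuous a, continuous b,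
        forall g x, phi (S g x) = T (a (g, x)) (phi x) &
        forall h y, psi (T h y) = S (b (h, y)) (psi y)].

Definition conjugate (G H : groupType) (X Y : topologicalType)
    (S : dynsys G X) (T : dynsys H Y) : Prop :=
  exists (phi : X -> Y) (psi : Y -> X) (rho : {multiplicative G -> H}),
    [/\ homeo_pair phi psi, bijective rho &
        forall g x, phi (S g x) = T (rho g) (phi x)].

Definition cts_int (X : topologicalType) : Type :=
  continuousType X (discrete_topology int).

Section CtsInt.
Context (X : topologicalType).
Implicit Types f g : cts_int X.
Local Notation Z := (discrete_topology int).

HB.instance Definition _ := Choice.copy (cts_int X) (continuousType X Z).

Fact cts_int_op2 (op : int -> int -> int) f g :
  continuous (fun x => op (f x) (g x) : Z).
Proof.
move=> x; apply/discrete_cvg.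
have /discrete_cvg fx : (f : X -> Z) y @[y --> x] --> (f x : Z).
  exact: cts_fun.
have /discrete_cvg gx : (g : X -> Z) y @[y --> x] --> (g x : Z).
  exact: cts_fun.
apply: (@filterS2 X (nbhs x) (nbhs_filter x) _ _ _ _ fx gx) => y /= fy gy.
by rewrite fy gy.
Qed.

Definition cts_int_zero : cts_int X := cst (0 : Z).
Definition cts_int_opp f : cts_int X :=
  mkcts (@cts_int_op2 (fun m _ => - m) f f).
Definition cts_int_add f g : cts_int X :=
  mkcts (@cts_int_op2 (fun m n => m + n) f g).

Fact cts_int_addA : associative cts_int_add.
Proof. by move=> f g h; apply/continuousEP => x; exact: addrA. Qed.
Fact cts_int_addC : commutative cts_int_add.
Proof. by move=> f g; apply/continuousEP => x; exact: addrC. Qed.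
Fact cts_int_add0 : left_id cts_int_zero cts_int_add.
Proof. by move=> f; apply/continuousEP => x; exact: add0r. Qed.
Fact cts_int_addN : left_inverse cts_int_zero cts_int_opp cts_int_add.
Proof. by move=> f; apply/continuousEP => x; exact: addNr. Qed.

HB.instance Definition _ := GRing.isZmodule.Build (cts_int X)
  cts_int_addA cts_int_addC cts_int_add0 cts_int_addN.

Definition cts_int_const (k : int) : cts_int X := cst (k : Z).

End CtsInt.

Section CtsIntAction.
Context (G : groupType) (X : topologicalType) (S : dynsys G X).

Fact cts_int_translate (g : G) (f : cts_int X) :
  continuous ((f : X -> discrete_topology int) \o S g^-1%g).
Proof.
by move=> x; apply: continuous_comp; [exact: act_cts | exact: cts_fun].
Qed.

Definition cts_int_act (g : G) (f : cts_int X) : cts_int X :=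
  mkcts (@cts_int_translate g f).

Fact cts_int_act1 f : cts_int_act 1%g f = f.
Proof. by apply/continuousEP => x /=; rewrite /mkcts /= invg1 act1. Qed.

Fact cts_int_actM g h f :
  cts_int_act (g * h)%g f = cts_int_act g (cts_int_act h f).
Proof. by apply/continuousEP => x /=; rewrite /mkcts /= invgM actM. Qed.

Fact cts_int_actD g : {morph cts_int_act g : f1 f2 / f1 + f2}.
Proof. by move=> f1 f2; apply/continuousEP. Qed.

Definition cts_int_action : group_action G (cts_int X) :=
  GroupAction cts_int_act1 cts_int_actM cts_int_actD.

Definition cts_int_module : lmodType (group_ring G) := gmodule cts_int_action.

Definition almost_projective : Prop :=
  exists (P : lmodType (group_ring G))
         (Phi : {linear (trivial_int G * P)%type -> cts_int_module}),
    [/\ projective P, bijective Phi &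
        forall k : int, Phi (k, 0) = cts_int_const X k].

End CtsIntAction.

(* Main.v *)
(* Write the orbit equivalence as [phi (g.x) = a(g,x).phi x], with [a] a locally
   constant cocycle, and C(X,Z) = Z (+) P with P projective.

   If G is one-ended, [a] is cohomologous to a homomorphism rho.  Go down the
   derived series of H: modulo the next term one meets 1-cocycles (up to
   constants) with values in C(X,A) = A (+) (P (x) A), where A is abelian.  As P
   is a summand of a free module, their P-part is given by functions on copies
   of G that are invariant under translations up to finitely many values;
   one-endedness makes these constant up to finitely many values, so the P-part
   is a coboundary.

   If a(g,x) = u(g.x) rho(g) u(x)^-1, then phi' x = u(x)^-1.phi x is equivariant.
   The projection tau : C(X,Z) -> Z plays the role of an invariant probability
   measure (no positivity is needed).  The finite group ker rho acts freely with
   a clopen fundamental domain E, so 1 = |ker rho| tau(1_E); and Y is the disjoint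
   union of the translates h.phi'(X), h in H / rho(G), each of measure 1.  Hence
   rho is bijective and phi' is a homeomorphism.

   If G is not one-ended then H^1(G,ZG) <> 0, so G is a duality group of
   dimension 1.  The bijection a(-,x) transports edge cuts from G to the solvable
   group H, which is therefore virtually cyclic and two-ended.  So G is
   two-ended; being torsion-free (it is of type FP), it is infinite cyclic. *)
From HB Require Import structures.
Require Import Defs.
From mathcomp Require Import all_boot all_order all_algebra finmap zify.
From mathcomp Require Import all_classical topology.

Set Implicit Arguments.
Unset Strict Implicit.
Unset Printing Implicit Defensive.

Import Order.TTheory GRing.Theory Num.Theory.
Local Open Scope classical_set_scope.

(** Ends are handled through functions on G that each left translation changes at finitely many
    points only. H^1(G, ZG) = 0 speaks of boolean ones; finite generation of G, inherited from H
    through the orbit equivalence, extends the conclusion to values in K/L for consecutive terms K,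
    L of the derived series. Finite generation also meets the second obstacle: P may have infinite
    rank, so a primitive of the coordinate cocycle might live on infinitely many basis orbits. A
    component that no generator changes is constant and is normalised to zero, and all but finitely
    many components are of this kind. Since [tau] need not be positive, no inequality between
    measures is available; every measure argument ends instead with an equation in the integers,
    such as 1 = |F| * t, which integrality decides. Torsion-freeness of G comes from the periodic
    Tate cohomology of a finite cyclic subgroup, which vanishes on projective modules but not on
    Z. *)

Section AlmostAll.
Context {T U I : Type}.
Implicit Types (D : set T) (P Q : T -> Prop).

Definition ae {T} (D : set T) (P : T -> Prop) : Prop :=
  finite_set [set x | D x /\ ~ P x].

Lemma ae_imp D P Q : (forall x, D x -> P x -> Q x) -> ae D P -> ae D Q.
Proof.
by move=> PQ; apply: sub_finite_set => x [Dx nQ]; split=> // /PQ-/(_ Dx).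
Qed.

Lemma aeI D P Q : ae D P -> ae D Q -> ae D (fun x => P x /\ Q x).
Proof.
move=> DP DQ; apply: (@sub_finite_set _ _ ([set x | D x /\ ~ P x] `|`
   [set x | D x /\ ~ Q x])); last by rewrite finite_setU.
move=> x [Dx nPQ]; have [Px|nPx] := pselect (P x); last by left.
by right; split=> // Qx; apply: nPQ.
Qed.

Lemma ae_fin (A : set I) D (P : I -> T -> Prop) : finite_set A ->
  (forall i, A i -> ae D (P i)) -> ae D (fun x => forall i, A i -> P i x).
Proof.
move=> Afin DP.
apply: (sub_finite_set _ (bigcup_finite Afin DP)) => x [Dx].
by move=> /existsNP[i /not_implyP[Ai nP]]; exists i.
Qed.

Lemma ae_ex D P : infinite_set D -> ae D P -> exists x, D x /\ P x.
Proof.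
move=> Dinf DP; apply: contrapT => nex; apply: Dinf.
by apply: sub_finite_set DP => x Dx; split=> // Px; apply: nex; exists x.
Qed.

Lemma ae_inj (f : U -> T) (E : set U) D P : injective f ->
  (forall x, E x -> D (f x)) -> ae D P -> ae E (P \o f).
Proof.
move=> finj fED DP.
have /sub_finite_set : [set x | E x /\ ~ (P \o f) x] `<=`
    f @^-1` [set x | D x /\ ~ P x] by move=> x /= [/fED].
apply; apply: finite_preimage => //.
by move=> x y _ _; apply: finj.
Qed.

End AlmostAll.

Lemma ae_nat (P : nat -> Prop) : ae setT P -> exists M, forall m, (M <= m)%N -> P m.
Proof.
move=> /finite_fsetP[X XP]; exists (\max_(i <- X) i).+1 => m Mm.
apply: contrapT => nP; have mX : m \in X.
  by have : [set` X] m by rewrite -XP.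
have : (m <= \max_(i <- X) i)%N by rewrite (big_rem m) ?leq_maxl.
by rewrite leqNgt Mm.
Qed.

Lemma step_change (T : Type) (f : nat -> T) n : f 0%N <> f n ->
  exists2 j, (j < n)%N & f j <> f j.+1.
Proof.
elim: n => // n IH f0n; have [e|ne] := pselect (f n = f n.+1); last by exists n.
by case: IH => [|j jn fj]; [rewrite e | exists j => //; apply: ltnW].
Qed.

(** * Generating sets, and cosets of a cyclic subgroup *)

Section Groups.
Context {G : groupType}.
Local Open Scope group_scope.
Implicit Types (g x y : G) (N : set G).

(** The elements that map V into itself together with their inverses form a subgroup containing A.
    So V, which has a point, is stable under all of G and is everything. *)
Lemma generated_ind (A V : set G) x : generated A = [set: G] ->
  (forall y s, V y -> A s -> V (s * y) /\ V (s^-1 * y)) -> V x ->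
  forall y, V y.
Proof.
move=> AG VA Vx y.
pose K := [set z : G | forall w, V w -> V (z * w) /\ V (z^-1 * w)].
have KG : is_subgroup K.
  split=> [w|z t Kz Kt w Vw] /=; first by rewrite invg1 !mul1g.
  split; first by rewrite -mulgA; apply: (Kz _ _).1; apply: (Kt _ _).2.
  by rewrite invgM invgK -mulgA; apply: (Kt _ _).1; apply: (Kz _ _).2.
have AK : A `<=` K by move=> s As w Vw; apply: VA.
have Kall z : K z.
  have : generated A z by rewrite AG.
  by apply; split.
by have [+ _] := Kall (y * x^-1) x Vx; rewrite mulgVK.
Qed.

Definition infinite_order g := forall n, (0 < n)%N -> g ^+ n <> 1.

Lemma infinite_orderV g : infinite_order g -> infinite_order g^-1.
Proof.
move=> go n n0; rewrite expVgn => e; apply: (go n n0).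
by rewrite -[LHS]invgK e invg1.
Qed.

Lemma expg_inj g x : infinite_order g -> injective (fun n => x * g ^+ n).
Proof.
move=> go; have aux m n : (m < n)%N -> x * g ^+ m <> x * g ^+ n.
  move=> mn /mulgI e; apply: (go (n - m)%N); rewrite ?subn_gt0 //.
  by rewrite expgnFr ?(ltnW mn) // e mulgV.
by move=> m n e; case: (ssrnat.ltngtP m n) => // /aux; rewrite e.
Qed.

Lemma expgMV g m n x : x * g ^- n * g ^+ m = x * g ^+ m * g ^- n.
Proof.
rewrite -!mulgA; congr (_ * _); apply/esym/commuteV/commuteX2.
exact: commute_refl.
Qed.

Lemma subgroup1 N : is_subgroup N -> N 1. Proof. by case. Qed.

Lemma subgroupV N x : is_subgroup N -> N x -> N x^-1.
Proof. by case=> N1 NV Nx; rewrite -[x^-1]mul1g; apply: NV. Qed.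

Lemma subgroupM N x y : is_subgroup N -> N x -> N y -> N (x * y).
Proof.
by move=> sN Nx Ny; rewrite -[y]invgK; apply: (sN.2) => //; apply: subgroupV.
Qed.

Lemma subgroupX N x n : is_subgroup N -> N x -> N (x ^+ n).
Proof.
move=> sN Nx; elim: n => [|n IH]; first exact: subgroup1.
by rewrite expgS; apply: subgroupM.
Qed.

Lemma subgroupT : is_subgroup [set: G]. Proof. by []. Qed.

(* N is covered by finitely many left cosets r<g>; [x * g ^+ m = r * g ^+ n]
   stands for x \in r<g>, there being no integer powers in a [groupType]. *)
Definition finitely_many_cosets N g := exists2 R : set G, finite_set R &
  forall x, N x -> exists r m n, R r /\ x * g ^+ m = r * g ^+ n.

(** Pigeonhole: two powers of y lie in the same coset of <g>, up to right multiplication by <g>, so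
    a positive power of y lies in <g>. *)
Lemma finitely_many_cosets_pow N g y : is_subgroup N ->
  finitely_many_cosets N g -> N y ->
  exists p a b, (0 < p)%N /\ y ^+ p * g ^+ a = g ^+ b.
Proof.
move=> sN [R Rfin RN] Ny.
have /choice[r rP] i : exists r, exists m n, R r /\ y ^+ i * g ^+ m = r * g ^+ n.
  by apply: RN; apply: subgroupX.
have [i [j [ij rij]]] : exists i j, (i < j)%N /\ r i = r j.
  apply: contrapT => nij.
  have rI : injective r.
    move=> i j rij; have [ij|ji|//] := ssrnat.ltngtP i j; case: nij.
      by exists i, j.
    by exists j, i.
  have : finite_set (r @^-1` R).
    by apply: finite_preimage => // i j _ _; apply: rI.
  have -> : r @^-1` R = setT.
    by apply/seteqP; split=> // i _; have [m [n []]] := rP i.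
  exact: infinite_nat.
have [m [n [_ e1]]] := rP i; have [m' [n' [_ e2]]] := rP j.
exists (j - i)%N, (m' + n)%N, (m + n')%N; split; first by rewrite subn_gt0.
have e1' : r i = y ^+ i * g ^+ m * g ^- n by rewrite e1 mulgK.
have e2' : r j = y ^+ j * g ^+ m' * g ^- n' by rewrite e2 mulgK.
move: rij; rewrite e1' e2' -(subnKC (ltnW ij)) expgnDr -!mulgA => /mulgI.
rewrite addKn => e.
have : g ^+ m * g ^- n * (g ^+ n * g ^+ n') =
  y ^+ (j - i) * (g ^+ m' * g ^- n') * (g ^+ n' * g ^+ n).
  by rewrite e -!expgnDr [(n' + n)%N]addnC.
by rewrite !mulgA !mulgVK -!mulgA -!expgnDr.
Qed.

End Groups.

(** * Ends of groups *)

Section AlmostInvariant.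
Context {G : groupType}.
Local Open Scope group_scope.
Implicit Types (g x y : G) (N : set G).

(** For boolean f and N = G these are the sets with finite edge boundary in the Cayley graph with
    edges x -- s x. Right translates of such a function are again almost invariant. *)
Definition almost_invariant_on {T} N (f : G -> T) :=
  forall s, N s -> ae N (fun x => f (s * x) = f x).

Definition almost_constant_on {T} N (f : G -> T) :=
  exists c, ae N (fun x => f x = c).

Definition almost_invariant {T} (f : G -> T) :=
  forall s, ae [set: G] (fun x => f (s * x) = f x).

Definition almost_constant {T} (f : G -> T) :=
  exists c, ae [set: G] (fun x => f x = c).

Lemma almost_invariantW {T} N (f : G -> T) :
  almost_invariant f -> almost_invariant_on N f.
Proof. by move=> fI s Ns; apply: sub_finite_set (fI s) => x [_]. Qed.

(** Left multiplication by g shifts the sequence of powers of g, so f is eventually constant along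
    it; left multiplication by x then changes only finitely many terms. Hence e, the value of f at
    this end, does not depend on x. *)
Lemma limit_along_powers {T} N (f : G -> T) g : is_subgroup N -> N g ->
  infinite_order g -> almost_invariant_on N f ->
  exists e, forall x, N x -> exists M, forall m, (M <= m)%N ->
    f (x * g ^+ m) = e.
Proof.
move=> sN Ng go fI.
have Npow n : N (1 * g ^+ n) by rewrite mul1g; apply: subgroupX.
have along s : N s ->
    exists M, forall m, (M <= m)%N -> f (s * g ^+ m) = f (g ^+ m).
  move=> Ns.
  have /ae_nat[M MP] := ae_inj (E := setT) (@expg_inj _ g 1 go)
    (fun n _ => Npow n) (fI s Ns).
  by exists M => m Mm; have /= := MP m Mm; rewrite mul1g.
have [M MP] := along g Ng; exists (f (g ^+ M)).
have fM m : (M <= m)%N -> f (g ^+ m) = f (g ^+ M).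
  elim: m => [|m IH]; first by rewrite leqn0 => /eqP ->.
  rewrite leq_eqVlt => /orP[/eqP-> //|]; rewrite ltnS => Mm.
  by rewrite expgS MP // IH.
move=> x /along[M' M'P]; exists (maxn M M') => m.
by rewrite geq_max => /andP[Mm M'm]; rewrite M'P ?fM.
Qed.

(** Let D be the finite set where f changes under right multiplication by g. If the limits [ep] and
    [em] along the positive and negative powers of g agreed, f would be almost constant on N; as
    they differ, f changes somewhere on each coset x<g>, which therefore meets D. *)
Lemma virtually_cyclic_of_right_invariant N (f : G -> bool) g :
  is_subgroup N -> N g -> infinite_order g -> almost_invariant_on N f ->
  ae N (fun x => f (x * g) = f x) -> ~ almost_constant_on N f ->
  finitely_many_cosets N g /\ forall e, exists M, forall n,
    (M <= n)%N -> f (g ^+ n) <> e \/ f (g ^- n) <> e.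
Proof.
move=> sN Ng go fI fg fnc.
have NgX n : N (g ^+ n) by apply: subgroupX.
have NgV n : N (g ^- n) by apply: subgroupV.
have [ep epP] := limit_along_powers sN Ng go fI.
have [em emP] := limit_along_powers sN (subgroupV sN Ng) (infinite_orderV go) fI.
pose D := [set x | N x /\ f (x * g) <> f x].
have epm : ep <> em.
  move=> epm; apply: fnc; exists ep.
  have /choice[M MP] d : exists M, D d ->
      forall m, (M <= m)%N -> f (d * g ^- m) = ep.
    have [[Nd _]|nDd] := pselect (D d); last by exists 0%N.
    by have [M MP] := emP d Nd; exists M => _ m /MP; rewrite expVgn epm.
  have := @bigcup_finite _ _ D
    (fun d => (fun m => d * g ^- m) @` [set m | (m < M d)%N]) fg.
  move=> /(_ (fun d _ => finite_image _ (finite_II (M d)))).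
  apply: sub_finite_set => y [Ny fy].
  have [M0 M0P] := epP y Ny.
  have [|j jM fj] := @step_change _ (fun j => f (y * g ^+ j)) M0.
    by rewrite expg0 mulg1 M0P // => ?; apply: fy.
  (* The ray y, y g, y g^2, ... first enters {f = ep} right after a point d of D. Then y = d g^-m,
     and m is below the bound [M d], since beyond it f (d g^-m) = ep. *)
  have [m fm mmin] := @ex_minnP (fun m => f (y * g ^+ m) == ep)
    (ex_intro _ M0 (introT eqP (M0P M0 (leqnn _)))).
  case: m => [|m] in fm mmin *.
    by move: fm; rewrite expg0 mulg1 => /eqP.
  have fm' : f (y * g ^+ m) <> ep.
    by move=> /eqP /mmin; rewrite ltnn.
  have Dym : D (y * g ^+ m).
    split; first by apply: subgroupM.
    by rewrite -mulgA -expgSr (eqP fm); apply/nesym.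
  exists (y * g ^+ m) => //; exists m; last by rewrite mulgK.
  rewrite /= ltnNge; apply/negP => /(MP _ Dym); rewrite mulgK.
  exact: fy.
split; last first.
  move=> e.
  have [M MP] := epP 1 (subgroup1 sN); have [M' M'P] := emP 1 (subgroup1 sN).
  exists (maxn M M') => n; rewrite geq_max => /andP[/MP + /M'P].
  rewrite !mul1g expVgn => -> ->.
  have [epe|] := pselect (ep = e); last by left.
  by right; rewrite -epe; apply/nesym.
exists D => // x Nx.
have [M MP] := epP x Nx; have [M' M'P] := emP x Nx.
(* The walk from x g^-M' to x g^M joins the two limiting values. *)
have [|j jM fj] := @step_change _ (fun j => f (x * g ^- M' * g ^+ j)) (M' + M).
  rewrite expg0 mulg1 -expVgn M'P // expVgn expgnDr mulgA mulgVK MP //.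
  exact/nesym.
exists (x * g ^- M' * g ^+ j), j, M'; split.
  split; first by apply: subgroupM => //; apply: subgroupM.
  by rewrite -mulgA -expgSr; apply/nesym.
by rewrite expgMV mulgVK.
Qed.

End AlmostInvariant.

Lemma infinite_uniq_seq (T : eqType) (A : set T) n : infinite_set A ->
  exists s : seq T, [/\ uniq s, size s = n & forall x, x \in s -> A x].
Proof.
move=> Ainf; elim: n => [|n [s [us ss sA]]]; first by exists [::].
have /infinite_setN0[x [Ax xs]] : infinite_set (A `\` [set` s]).
  move=> fin; apply: Ainf; apply: (@sub_finite_set _ _ ((A `\` [set` s]) `|` [set` s])).
    by move=> x Ax; have [xs|xs] := pselect (x \in s); [right|left].
  by rewrite finite_setU; split.
exists (x :: s); split => /=; [|by rewrite ss|].
  by rewrite us andbT; apply/negP.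
by move=> y; rewrite inE => /orP[/eqP->|/sA].
Qed.

(** * Nested cuts, normal subgroups and the derived series *)

Section Ends.
Context {G : groupType}.
Local Open Scope group_scope.
Implicit Types (g x y : G) (N : set G).

Definition normal N := forall x y, N x -> N (x ^ y).

(* With E = {x | f x}, one of the translates of E or of its complement by g
   lies in E or in its complement: the nested-sets trick for edge cuts of the
   Cayley graph. *)
Lemma almost_all_nested (A : set G) (f : G -> bool) :
  finite_set A -> generated A = [set: G] -> almost_invariant f ->
  ae [set: G] (fun g => forall x, f (x * g^-1) = f g^-1 \/ f x = f g).
Proof.
move=> Afin AG fI.
pose D := \bigcup_(s in A) ([set x | setT x /\ f (s * x) <> f x] `|`
                            [set x | setT x /\ f (s^-1 * x) <> f x]).
have Dfin : finite_set D.
  by apply: bigcup_finite => // s _; rewrite finite_setU; split; apply: fI.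
have D1 : ae [set: G] (fun g => forall d, D d -> f (d * g) = f g).
  by apply: ae_fin => // d _; apply: fI.
have D2 : ae [set: G] (fun g => forall d, D d -> f (d * g^-1) = f g^-1).
  exact: (ae_inj (@invg_inj G) (fun x (_ : setT x) => I) D1).
apply: ae_imp (aeI D1 D2) => g _ [gP gP'] x; apply: contrapT => nx.
(* A generator that changes f at y g^-1, or at y, puts that point into D, and the choice of g then
   grants one of the two alternatives at y. So V is stable under the generators; but 1 is not in
   V. *)
pose V y := ~ (f (y * g^-1) = f g^-1 \/ f y = f g).
suff : V 1 by apply; left; rewrite mul1g.
apply: (generated_ind AG _ (nx : V x)) => y s Vy As.
have step t : t = s \/ t = s^-1 -> V (t * y).
  move=> ts; have inD z : f (t * z) <> f z -> D z.
    by move=> fz; exists s => //; case: ts fz => ->; [left | right].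
  have e1 : f (t * y * g^-1) = f (y * g^-1).
    apply: contrapT; rewrite -mulgA => /inD/gP; rewrite mulgVK => fy.
    by apply: Vy; right.
  have e2 : f (t * y) = f y.
    by apply: contrapT => /inD/gP' fy; apply: Vy; left.
  by rewrite /V e1 e2.
by split; apply: step; [left|right].
Qed.

(* With E = {x | f x <> c}, almost all n in N satisfy E :&: E n = set0, whereas
   if E is infinite some y in E has arbitrarily many N-translates in E. *)
Lemma almost_constant_of_normal (A : set G) N (f : G -> bool) c :
  finite_set A -> generated A = [set: G] -> almost_invariant f ->
  is_subgroup N -> normal N -> infinite_set N ->
  ae N (fun x => f x = c) -> ae [set: G] (fun x => f x = c).
Proof.
move=> Afin AG fI sN nN Ninf fNc; apply: contrapT => Einf.
have : ae N (fun n => forall x, f (x * n^-1) = c \/ f x = c).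
  have := almost_all_nested Afin AG fI.
  move=> /(sub_finite_set _)-/(_ [set x | N x /\ ~ (forall x0,
     f (x0 * x^-1) = f x^-1 \/ f x0 = f x)])/=.
  move=> /(_ (fun x H => conj I H.2)) nest.
  have fNc' : ae N (fun x => f x^-1 = c).
    apply: (ae_inj (@invg_inj G) _ fNc) => x; exact: subgroupV.
  apply: ae_imp (aeI nest (aeI fNc fNc')) => n _ [+ [fn fn']] x.
  by move=> /(_ x); rewrite fn fn'.
move=> /finite_seqP[B BP].
have [a [ua sa aN]] := infinite_uniq_seq (size B).+1 Ninf.
have aI : ae [set x | setT x /\ f x <> c]
    (fun x => forall n, [set` a] n -> f (n * x) = f x).
  by apply: ae_fin => // n _; apply: sub_finite_set (fI n) => x [].
have [y [[_ fy] ay]] := ae_ex Einf aI.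
(* Normality turns the left translates n y into right translates y (n ^ y). As f (n y) = f y differs
   from c, each (n ^ y)^-1 is one of the exceptions listed in B, yet there are more of them than B
   holds. *)
have : (size [seq (n ^ y)^-1 | n <- a] <= size B)%N.
  apply: uniq_leq_size.
    by rewrite map_inj_uniq // => n m /invg_inj/conjg_inj.
  move=> _ /mapP[n an ->].
  suff : [set` B] (n ^ y)^-1 by [].
  rewrite -BP; split; first by apply: subgroupV => //; apply: nN; apply: aN.
  move=> /(_ y)[]; last exact: fy.
  by rewrite invgK conjgE mulVKg ay.
by rewrite size_map sa ltnn.
Qed.

(** Otherwise right multiplication by g maps {f = f g} into itself, so this set contains all
    positive powers of g, among them g^-1. *)
Lemma nested_torsion (f : G -> bool) g k :
  (forall x, f (x * g^-1) = f g^-1 \/ f x = f g) ->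
  (0 < k)%N -> g ^+ k = 1 -> f g^-1 = f g.
Proof.
move=> gP k0 gk; apply: contrapT => fg.
have step x : f x = f g -> f (x * g) = f g.
  move=> fx; have [|//] := gP (x * g); rewrite mulgK fx => /esym; by [].
have fpow j : f (g ^+ j.+1) = f g.
  by elim: j => [|j IH]; rewrite ?expg1 // expgSr step.
(* The extra k keeps the exponent positive when k = 1. *)
have : g^-1 = g ^+ (k + k.-1).
  apply: (mulIg g); rewrite mulVg -expgSr -addnS prednK //.
  by rewrite expgnDr gk mulg1.
by case: k k0 gk => // k _ gk e; apply: fg; rewrite e addSn fpow.
Qed.

(** A ping-pong argument with E = {f = true} and its complement E'. Were N torsion, nestedness and
    [nested_torsion] would give n and m in N with E' n^-1 inside E and E m^-1 inside E'. Then p =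
    n^-1 m^-1 maps E' into itself, hence onto itself as it has finite order (this is [back]), and
    evaluation at 1 and at m n is contradictory. *)
Lemma infinite_order_of_split (A : set G) N (f : G -> bool) :
  finite_set A -> generated A = [set: G] -> almost_invariant f ->
  is_subgroup N -> ~ almost_constant_on N f ->
  exists2 g, N g & infinite_order g.
Proof.
move=> Afin AG fI sN fnc; apply: contrapT => ntors.
have tors g : N g -> exists2 k, (0 < k)%N & g ^+ k = 1.
  move=> Ng; apply: contrapT => nk; apply: ntors; exists g => // n n0 gn.
  by apply: nk; exists n.
have good b : exists n, N n /\ (f n = b /\
    forall x, f (x * n^-1) = f n^-1 \/ f x = f n).
  have Einf : infinite_set [set n | N n /\ f n = b].
    move=> Efin; apply: fnc; exists (~~ b).
    apply: sub_finite_set Efin => n [Nn fn]; split => //.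
    by case: (f n) fn; case: b.
  have := almost_all_nested Afin AG fI.
  move=> /(sub_finite_set _) => /(_ [set x | [set n | N n /\ f n = b] x /\
    ~ (forall x0, f (x0 * x^-1) = f x^-1 \/ f x0 = f x)]).
  move=> /(_ (fun x H => conj I H.2)) /(ae_ex Einf)[n [[Nn fn] nP]].
  by exists n.
have [n [Nn [fn nP]]] := good true; have [m [Nm [fm mP]]] := good false.
have [kn kn0 kn1] := tors n Nn; have [km km0 km1] := tors m Nm.
have fnV := nested_torsion nP kn0 kn1; have fmV := nested_torsion mP km0 km1.
rewrite fnV fn in nP; rewrite fmV fm in mP.
pose p := n^-1 * m^-1.
have [k k0 kp] : exists2 k, (0 < k)%N & p ^+ k = 1.
  by apply: tors; apply: subgroupM => //; apply: subgroupV.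
have step x : f x = false -> f (x * p) = false.
  move=> fx; have [fxn|] := nP x; last by rewrite fx.
  by rewrite /p mulgA; have [//|] := mP (x * n^-1); rewrite fxn.
have back x : f (x * p) = false -> f x = false.
  move=> fx; have : forall j, f (x * p ^+ j.+1) = false.
    by elim=> [|j IH]; rewrite ?expg1 // expgSr mulgA step.
  by move=> /(_ k.-1); rewrite prednK // kp mulg1.
have f1 : f 1 = false.
  have [h|] := mP 1; last by [].
  by have := back n; rewrite /p mulVKg -[m^-1]mul1g h fn => /(_ erefl).
have : f (m * n) = false by apply: back; rewrite /p mulgA mulgK mulgV.
by have [|] := nP (m * n); [rewrite mulgK fm | move=> ->].
Qed.

Lemma sub_generated (A : set G) : A `<=` generated A.
Proof. by move=> x Ax B [_]; apply. Qed.

Lemma generated_subgroup (A : set G) : is_subgroup (generated A).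
Proof.
split=> [B [[]] //|x y Ax Ay B BP].
by apply: (BP.1.2); [apply: Ax | apply: Ay].
Qed.

Lemma generated_sub (A N : set G) : is_subgroup N -> A `<=` N ->
  generated A `<=` N.
Proof. by move=> sN AN x; apply. Qed.

Lemma generated_normal (A : set G) : normal A -> normal (generated A).
Proof.
move=> nA x y Ax.
suff : generated A `<=` [set z | generated A (z ^ y)] by apply.
have [g1 gV] := generated_subgroup A.
apply: generated_sub => [|z Az]; last by apply: sub_generated; apply: nA.
split => [|z t Az At] /=; first by rewrite conj1g.
by rewrite conjMg conjVg; apply: gV.
Qed.

Lemma derived_subgroup n : is_subgroup (derived_series n : set G).
Proof. by case: n => [|n] //; apply: generated_subgroup. Qed.

Lemma derived_normal n : normal (derived_series n : set G).
Proof.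
elim: n => [|n IH] //=; apply: generated_normal => _ y [a [b [Da Db ->]]].
by exists (a ^ y), (b ^ y); split; [apply: IH | apply: IH | rewrite conjRg].
Qed.

Lemma derived_commg n x y : derived_series n x -> derived_series n y ->
  (derived_series n.+1 : set G) [~ x, y].
Proof. by move=> Dx Dy; apply: sub_generated; exists x, y. Qed.

Lemma derivedS n : (derived_series n.+1 : set G) `<=` derived_series n.
Proof.
have sD := derived_subgroup n.
apply: generated_sub => // _ [x [y [Dx Dy ->]]]; rewrite commgEl.
by apply: subgroupM => //; [apply: subgroupV | apply: derived_normal].
Qed.
End Ends.

(** * Solvable groups with a nontrivial cut *)

Section SolvableEnds.
Context {G : groupType}.
Local Open Scope group_scope.
Implicit Types (g x y : G) (N : set G).

Lemma last_infinite_derived : solvable_group G -> infinite_set [set: G] ->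
  exists n, infinite_set (derived_series n : set G) /\
    finite_set (derived_series n.+1 : set G).
Proof.
move=> [d Dd] Ginf; apply: contrapT => nn.
have : infinite_set (derived_series d : set G).
  elim: d {Dd} => [//|d IH] fin; apply: nn; exists d; split=> //.
by rewrite Dd; apply.
Qed.

(** Let N be the last infinite term of the derived series. It is normal and infinite, so f is not
    almost constant on N either; its commutators form a finite set, so right multiplication by an
    element g of infinite order almost preserves f on N, and N is virtually <g>. Finally N has
    finite index: every coset xN meets the finite set D where f changes under left multiplication by
    g. *)
Lemma solvable_virtually_cyclic (f : G -> bool) :
  finitely_generated_group G -> solvable_group G -> almost_invariant f ->
  ~ almost_constant f ->
  exists2 g, infinite_order g & finitely_many_cosets [set: G] g.
Proof.
move=> [A AG] Gsol fI fnc.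
have Afin : finite_set [set` A] by exact: finite_seq.
have Ginf : infinite_set [set: G].
  by move=> fin; apply: fnc; exists true; apply: sub_finite_set fin.
have [i [Dinf Dfin]] := last_infinite_derived Gsol Ginf.
pose N := derived_series i : set G.
have sN : is_subgroup N := derived_subgroup i.
have nN : normal N := @derived_normal _ i.
have fnN : ~ almost_constant_on N f.
  move=> [c fc]; apply: fnc; exists c.
  exact: (almost_constant_of_normal Afin AG fI sN nN).
have [g Ng go] := infinite_order_of_split Afin AG fI sN fnN.
have NgX n : N (g ^+ n) by apply: subgroupX.
have NgV n : N (g ^- n) by apply: subgroupV.
(* [x g x^-1] lies in the finite set [g N'] *)
have fg : ae N (fun x => f (x * g) = f x).
  have : ae N (fun x => forall t, (derived_series i.+1 : set G) t ->
      f (g * t * x) = f x).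
    by apply: ae_fin => // t _; apply: sub_finite_set (fI (g * t)) => x [].
  apply: ae_imp => x Nx /(_ [~ g, x^-1]).
  have -> : g * [~ g, x^-1] * x = x * g.
    by rewrite commgEl mulVKg conjgE invgK -!mulgA mulVg mulg1.
  apply.
  by apply: derived_commg => //; apply: subgroupV.
have [[R Rfin RN] fpow] := virtually_cyclic_of_right_invariant
  sN Ng go (almost_invariantW fI) fg fnN.
exists g => //; pose D := [set x | setT x /\ f (g * x) <> f x].
exists [set d * r | d in D & r in R].
  by apply: finite_image2 => //; apply: fI.
move=> x _.
suff [n [Nn Dxn]] : exists n, N n /\ D (x * n).
  have [|r [a [b [Rr e]]]] := RN n^-1; first exact: subgroupV.
  exists (x * n * r), a, b; split; first by exists (x * n) => //; exists r.
  by rewrite -!mulgA -e mulVKg.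
(* If xN misses D, then f is constant on the points g^k x = x (g ^ x)^k, for positive and negative
   k. A power of g ^ x is a power of g with nonzero exponent, so f takes the value f x at x g^n and
   at x g^-n for some large n, whereas f has distinct limits along the two rays. *)
apply: contrapT => nD.
have fgx n : N n -> f (g * (x * n)) = f (x * n).
  by move=> Nn; apply: contrapT => fn; apply: nD; exists n.
have gx k : g ^+ k * x = x * (g ^+ k) ^ x by exact: conjgC.
have gVx k : g ^- k * x = x * (g ^- k) ^ x by exact: conjgC.
have fp k : f (g ^+ k * x) = f x.
  elim: k => [|k IH]; first by rewrite expg0 mul1g.
  by rewrite expgS -mulgA gx fgx -?gx //; apply: nN.
have fm k : f (g ^- k * x) = f x.
  elim: k => [|k IH]; first by rewrite expg0 invg1 mul1g.
  have e : g * (g ^- k.+1 * x) = g ^- k * x.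
    by rewrite expgSr invgM !mulgA mulgV mul1g.
  by rewrite -IH -e gVx fgx //; apply: nN.
have Nx : N (g ^ x) by apply: nN.
have [p [a [b [p0 e]]]] := finitely_many_cosets_pow sN
  (ex_intro2 _ _ R Rfin RN) Nx.
have [M MP] : exists M, forall n, (M <= n)%N ->
    f (x * g ^+ n) = f (g ^+ n) /\ f (x * g ^- n) = f (g ^- n).
  have gI : injective (fun n => g ^+ n).
    by move=> m n mn; apply: (expg_inj (x := 1) go); rewrite /= !mul1g.
  apply: ae_nat; apply: aeI.
    exact: (ae_inj gI (fun n (_ : setT n) => I) (fI x)).
  exact: (ae_inj (f := fun n => g ^- n) (inj_comp (@invg_inj _) gI)
    (fun n (_ : setT n) => I) (fI x)).
have [M' M'P] := fpow (f x).
have key q : (0 < q)%N -> (g ^ x) ^+ p = g ^+ q \/ (g ^ x) ^+ p = g ^- q -> False.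
  move=> q0 gq; pose j := maxn M M'; have jq : (j <= q * j)%N by nia.
  have fxp k : f (x * (g ^ x) ^+ k) = f x by rewrite -conjXg -gx fp.
  have fxm k : f (x * (g ^ x) ^- k) = f x by rewrite -conjXg -conjVg -gVx fm.
  have [||] := M'P (q * j)%N; first by move: jq; rewrite geq_max => /andP[].
    case; have [|<- _] := MP (q * j)%N; first by lia.
    case: gq => gq; rewrite expgnA.
      by rewrite -gq -expgnA.
    have -> : g ^+ q = (g ^ x) ^- p by rewrite gq invgK.
    by rewrite expVgn -expgnA.
  case; have [|_ <-] := MP (q * j)%N; first by lia.
  case: gq => gq; rewrite expgnA -expVgn.
    by rewrite -gq expVgn -expgnA.
  by rewrite -gq -expgnA.
have [ab|ba|ab] := ssrnat.ltngtP a b.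
- apply: (key (b - a)%N); first by lia.
  by left; apply: (mulIg (g ^+ a)); rewrite e -expgnDr subnK ?(ltnW ab).
- apply: (key (a - b)%N); first by lia.
  right; apply: (mulIg (g ^+ a)); rewrite e -{2}(subnK (ltnW ba)) expgnDr.
  by rewrite mulKg.
- apply: (go p p0); apply/eqP; rewrite -(conjg_eq1 _ x) conjXg; apply/eqP.
  by apply: (mulIg (g ^+ a)); rewrite e ab mul1g.
Qed.

(** Up to finitely many values, an almost invariant boolean function is determined by its limits at
    the two ends of <g>. These differ for f and for f', so the sum of f and f' modulo 2 has equal
    limits and is almost constant. *)
Lemma two_ended_of_cosets g (f f' : G -> bool) :
  infinite_order g -> finitely_many_cosets [set: G] g ->
  almost_invariant f -> almost_invariant f' ->
  ~ almost_constant f -> ~ almost_constant f' ->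
  exists b, ae [set: G] (fun x => f' x = b (+) f x).
Proof.
move=> go [R Rfin RG].
have lim (h : G -> bool) (hI : almost_invariant h) := limit_along_powers
  subgroupT (I : setT g) go (almost_invariantW hI).
have limV (h : G -> bool) (hI : almost_invariant h) := limit_along_powers
  subgroupT (I : setT g^-1) (infinite_orderV go) (almost_invariantW hI).
have const (h : G -> bool) e : (forall x, exists M, forall m, (M <= m)%N ->
      h (x * g ^+ m) = e /\ h (x * g^-1 ^+ m) = e) ->
    ae [set: G] (fun x => h x = e).
  move=> /choice[M MP].
  have := @bigcup_finite _ _ R (fun r => ((fun m => r * g ^+ m) @` `I_(M r)) `|`
    ((fun m => r * g^-1 ^+ m) @` `I_(M r))) Rfin.
  have fin r : R r -> finite_set (((fun m => r * g ^+ m) @` `I_(M r)) `|`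
      ((fun m => r * g^-1 ^+ m) @` `I_(M r))).
    by move=> _; rewrite finite_setU; split; apply: finite_image.
  move=> /(_ fin); apply: sub_finite_set => x [_ hx].
  have [r [m [n [Rr e']]]] := RG x I; exists r => //.
  have [mn|nm] := leqP m n.
    left; exists (n - m)%N; last first.
      by rewrite expgnFr // mulgA -e' mulgK.
    rewrite /= ltnNge; apply/negP => /MP[+ _].
    by rewrite expgnFr // mulgA -e' mulgK.
  right; exists (m - n)%N.
    rewrite /= ltnNge; apply/negP => /MP[_ +].
    by rewrite expVgn expgnFr ?(ltnW nm) // invgM invgK mulgA -e' mulgK.
  by rewrite expVgn expgnFr ?(ltnW nm) // invgM invgK mulgA -e' mulgK.
move=> fI f'I fnc f'nc.
have [p pP] := lim f fI; have [q qP] := limV f fI.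
have [p' p'P] := lim f' f'I; have [q' q'P] := limV f' f'I.
have both (h : G -> bool) e :
    (forall x, setT x -> exists M, forall m, (M <= m)%N -> h (x * g ^+ m) = e) ->
    (forall x, setT x -> exists M, forall m, (M <= m)%N -> h (x * g^-1 ^+ m) = e) ->
    ae [set: G] (fun x => h x = e).
  move=> h1 h2; apply: const => x.
  have [M MP] := h1 x I; have [M' M'P] := h2 x I.
  by exists (maxn M M') => m; rewrite geq_max => /andP[/MP ? /M'P].
have pq : p != q.
  apply/eqP => e; apply: fnc; exists p; apply: both => //.
  by rewrite e.
have pq' : p' != q'.
  apply/eqP => e; apply: f'nc; exists p'; apply: both => //.
  by rewrite e.
exists (p (+) p').
have : ae [set: G] (fun x => f x (+) f' x = p (+) p').
  apply: both => x xT.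
    have [M MP] := pP x I; have [M' M'P] := p'P x I.
    by exists (maxn M M') => m; rewrite geq_max => /andP[/MP -> /M'P ->].
  have [M MP] := qP x I; have [M' M'P] := q'P x I.
  exists (maxn M M') => m; rewrite geq_max => /andP[/MP -> /M'P ->].
  by move: pq pq'; case: p {pP}; case: q {qP MP}; case: p' {p'P}; case: q' {q'P M'P}.
by apply: ae_imp => x _ <-; case: (f x); case: (f' x).
Qed.

End SolvableEnds.

(** * Torsion-free two-ended groups are infinite cyclic *)

Section Cyclic.
Context {G : groupType}.
Local Open Scope group_scope.
Implicit Types (g x y z : G).

Definition torsion_free := forall g, g <> 1 -> infinite_order g.

Section IntegerValuedMorphism.
Variable nu : G -> int.
Hypothesis nuM : forall x y, nu (x * y) = (nu x + nu y)%R.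

Lemma int_morph1 : nu 1 = 0%R.
Proof. by apply: (addrI (nu 1)); rewrite -nuM mulg1 addr0. Qed.

Lemma int_morphV x : nu x^-1 = (- nu x)%R.
Proof. by apply: (addrI (nu x)); rewrite -nuM mulgV int_morph1 subrr. Qed.

Lemma int_morphX x n : nu (x ^+ n) = (nu x *+ n)%R.
Proof.
by elim: n => [|n IH]; rewrite ?int_morph1 // expgS nuM IH mulrS.
Qed.

(** Division with remainder by n + 1, the least positive value of [nu]. *)
Lemma infinite_cyclic_of_int : infinite_set [set: G] ->
  (forall x, nu x = 0%R -> x = 1) -> infinite_cyclic G.
Proof.
move=> Ginf nuI; split=> //.
have [g0 [_ g0P]] : [set: G] `\ (1 : G) !=set0.
  apply: infinite_setN0 => fin; apply: Ginf.
  apply: (@sub_finite_set _ _ (([set: G] `\ (1 : G)) `|` [set 1])).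
    by move=> x _; have [->|] := pselect (x = 1); [right | left].
  by rewrite finite_setU; split.
pose P n := `[< exists g, nu g = (n.+1%:Z)%R >].
have [n Pn] : exists n, P n.
  have /eqP := contra_not (@nuI g0) g0P.
  case e : (nu g0) => [[|n]|n] // _; exists n; apply/asboolP.
    by exists g0.
  by exists g0^-1; rewrite int_morphV e NegzE opprK.
have [{Pn}{}n /asboolP[g gn] nmin] := ex_minnP (ex_intro P n Pn).
exists g; apply/seteqP; split=> // x _.
have [g1 gV] := generated_subgroup [set g].
have sK := generated_subgroup [set g].
have Kg : generated [set g] g by apply: sub_generated.
have [y Ky ny] : exists2 y, generated [set g] y &
    nu y = ((nu x %/ n.+1%:Z)%Z * n.+1%:Z)%R.
  case: (nu x %/ (n.+1%:Z)%R)%Z => k.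
    exists (g ^+ k); first exact: (subgroupX _ sK Kg).
    by rewrite int_morphX gn -mulr_natl natz.
  exists (g ^- k.+1); first exact: (subgroupV sK (subgroupX _ sK Kg)).
  by rewrite int_morphV int_morphX gn NegzE mulNr -mulr_natl natz.
have nr : nu (x * y^-1) = (nu x %% (n.+1%:Z)%R)%Z.
  by rewrite nuM int_morphV ny {1}(divz_eq (nu x) (n.+1%:Z)%R) addrAC subrr add0r.
suff xy : x * y^-1 = 1 by rewrite (divg1_eq xy).
apply: nuI; rewrite nr.
have := modz_ge0 (nu x) (isT : (n.+1%:Z != 0)%R).
have := ltz_pmod (nu x) (isT : (0 < n.+1%:Z)%R).
case e : (nu x %% (n.+1%:Z)%R)%Z => [[|r]|r] // rn _.
have /nmin : P r by apply/asboolP; exists (x * y^-1); rewrite nr.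
by move: rn; lia.
Qed.

End IntegerValuedMorphism.

Section Transfer.
Variable z : G.
Hypotheses (zo : infinite_order z) (zC : forall x, commute z x)
  (zfin : finitely_many_cosets [set: G] z) (Gtf : torsion_free).

Let rel x y := exists m n, x * z ^+ m = y * z ^+ n.
Let rep x := xget 1 [set y | rel x y].

Let zXC n x y : x * z ^+ n * y = x * y * z ^+ n.
Proof.
by rewrite -!mulgA; congr (_ * _); apply/commute_sym/commuteX/commute_sym/zC.
Qed.

Let rel_sym x y : rel x y -> rel y x.
Proof. by case=> m [n e]; exists n, m. Qed.

Let rel_trans x y w : rel x y -> rel y w -> rel x w.
Proof.
move=> [m [n e]] [m' [n' e']]; exists (m + m')%N, (n' + n)%N.
by rewrite !expgnDr !mulgA e zXC e'.
Qed.

Let repP x : rel x (rep x).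
Proof. by apply: (@xgetPex _ 1 [set y | rel x y]); exists x, 0%N, 0%N. Qed.

Let rep_eq x y : rel x y -> rep x = rep y.
Proof.
move=> xy; congr xget; apply/seteqP; split=> w /=.
  by apply: rel_trans; apply: rel_sym.
exact: rel_trans.
Qed.

(** The integer k is the exponent in x = rep x * z^k. *)
Let coordinate x : exists k : int,
  exists m n, x * z ^+ m = rep x * z ^+ n /\ k = (n%:Z - m%:Z)%R.
Proof. by have [m [n e]] := repP x; exists (n%:Z - m%:Z)%R, m, n. Qed.

Let c x := sval (cid (coordinate x)).

Let cP x : exists m n, x * z ^+ m = rep x * z ^+ n /\ c x = (n%:Z - m%:Z)%R.
Proof. exact: (svalP (cid (coordinate x))). Qed.

Let c_eq x y m n : x * z ^+ m = y * z ^+ n -> (c x + m%:Z = c y + n%:Z)%R.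
Proof.
move=> e; have rxy : rep x = rep y by apply: rep_eq; exists m, n.
have [a [b [xa ->]]] := cP x; have [a' [b' [ya ->]]] := cP y.
suff : (b + (m + a') = b' + (n + a))%N by lia.
apply: (expg_inj (x := rep x) zo) => /=.
rewrite !expgnDr !mulgA -xa (zXC a) e rxy -ya.
by rewrite -!mulgA -!expgnDr; congr (y * z ^+ _); lia.
Qed.

(* The transfer to the central subgroup <z>, identified with the integers. *)
Lemma transfer_to_central_cyclic : exists nu : G -> int,
  (forall x y, nu (x * y) = (nu x + nu y)%R) /\ (forall x, nu x = 0%R -> x = 1).
Proof.
have [R Rfin RG] := zfin.
have /finite_seqP[s0 s0P] : finite_set (rep @` R) by apply: finite_image.
pose s := undup s0.
have reps x : rep x \in s.
  rewrite mem_undup; suff : [set` s0] (rep x) by [].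
  rewrite -s0P; have [r [m [n [Rr e]]]] := RG x I.
  by exists r => //; apply: rep_eq; exists n, m.
have srep x : x \in s -> rep x = x.
  rewrite mem_undup => xs; have : [set` s0] x by [].
  by rewrite -s0P => -[r _ <-]; apply: rep_eq; apply: rel_sym.
have crep x : c (rep x) = 0%R.
  have [a [b [e cx]]] := cP x; have := c_eq e; rewrite cx; lia.
have cs x : x \in s -> c x = 0%R by move=> /srep <-.
pose nu g := (\sum_(x <- s) c (x * g))%R.
have nuM g h : nu (g * h) = (nu g + nu h)%R.
  (* Right multiplication by g permutes the cosets of <z>, so nu h may be summed over the
     representatives of the x g. *)
  have -> : nu h = (\sum_(y <- [seq rep (x * g) | x <- s]) c (y * h))%R.
    have us : uniq [seq rep (x * g) | x <- s].
      rewrite map_inj_in_uniq ?undup_uniq // => x y xs ys exy.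
      rewrite -(srep x xs) -(srep y ys); apply: rep_eq.
      have [m [n]] : rel (x * g) (y * g).
        by apply: (rel_trans (repP _)); rewrite exy; apply: rel_sym.
      by rewrite -!zXC => /mulIg e; exists m, n.
    have sub : {subset [seq rep (x * g) | x <- s] <= s}.
      by move=> _ /mapP[x xs ->].
    have [|_ si] := uniq_min_size us sub; first by rewrite size_map.
    by apply: perm_big; apply: uniq_perm; rewrite ?undup_uniq // => x; rewrite si.
  rewrite big_map -big_split; apply: eq_bigr => x _ /=.
  have [a [b [e ->]]] := cP (x * g).
  suff e' : (c (x * (g * h)) + a%:Z = c (rep (x * g) * h) + b%:Z)%R.
    by apply: (addIr a%:Z%R); rewrite e' [RHS]addrAC subrK addrC.
  by apply: c_eq; rewrite mulgA -(zXC a) e (zXC b).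
have nuz k : nu (z ^+ k) = ((size s)%:Z * k%:Z)%R.
  rewrite /nu big_seq (eq_bigr (fun=> (k%:Z)%R)) -?big_seq; last first.
    move=> x xs; have : (c (x * z ^+ k) + 0%:Z = c x + k%:Z)%R.
      by apply: c_eq; rewrite expg0 mulg1.
    by rewrite (cs x xs); lia.
  by rewrite big_const_seq count_predT iter_addr addr0 -mulr_natl natz.
have s_gt0 : (0 < size s)%N.
  by case: (s) (reps 1).
exists nu; split=> // x nux; apply: contrapT => /Gtf xo.
have [p [a [b [p0 e]]]] := finitely_many_cosets_pow subgroupT zfin (I : setT x).
apply: (xo p p0); have := congr1 nu e.
rewrite nuM int_morphX // nux mul0rn add0r !nuz => ab.
have {}ab : a = b by nia.
by apply: (mulIg (z ^+ a)); rewrite e ab mul1g.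
Qed.

End Transfer.

(** Right translation by g turns f into f or its negation, almost everywhere, so g^2 almost
    preserves f; hence <g^2> has finite index for every g other than 1. A power of g0 thus lies in
    <s^2> for each nontrivial generator s and commutes with s; a common power is central, and the
    transfer to it embeds G into the integers. *)
Lemma infinite_cyclic_of_two_ended (f : G -> bool) :
  finitely_generated_group G -> torsion_free -> almost_invariant f ->
  ~ almost_constant f ->
  (forall f' : G -> bool, almost_invariant f' -> ~ almost_constant f' ->
    exists b, ae [set: G] (fun x => f' x = b (+) f x)) ->
  infinite_cyclic G.
Proof.
move=> [A AG] Gtf fI fnc two.
have Ginf : infinite_set [set: G].
  by move=> fin; apply: fnc; exists true; apply: sub_finite_set fin.
have X2 g : g <> 1 -> infinite_order (g ^+ 2).
  by move=> /Gtf go n n0; rewrite -expgnA; apply: go; lia.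
have cos2 g : g <> 1 -> finitely_many_cosets [set: G] (g ^+ 2).
  move=> g1.
  have Rg (P : G -> Prop) : ae [set: G] P -> ae [set: G] (fun x => P (x * g)).
    exact: (ae_inj (@mulIg _ g) (fun x (_ : setT x) => I)).
  have Rg' (P : G -> Prop) : ae [set: G] (fun x => P (x * g)) -> ae [set: G] P.
    move=> /(ae_inj (@mulIg _ g^-1) (fun x (_ : setT x) => I)).
    by apply: ae_imp => x _ /=; rewrite mulgVK.
  have [b fb] : exists b, ae [set: G] (fun x => f (x * g) = b (+) f x).
    apply: two => [s|[c fc]].
      by apply: ae_imp (Rg _ (fI s)) => x _; rewrite mulgA.
    by apply: fnc; exists c; apply: Rg'.
  have [] := @virtually_cyclic_of_right_invariant G [set: G] f (g ^+ 2) => //.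
  - exact: X2.
  - apply: ae_imp (aeI fb (Rg _ fb)) => x _ [fx fxg].
    by rewrite expg2 mulgA fxg fx addKb.
have [g0 [_ g01]] : [set: G] `\ (1 : G) !=set0.
  apply: infinite_setN0 => fin; apply: Ginf.
  apply: (@sub_finite_set _ _ (([set: G] `\ (1 : G)) `|` [set 1])).
    by move=> x _; have [->|] := pselect (x = 1); [right | left].
  by rewrite finite_setU; split.
have comm s : exists2 k, (0 < k)%N & commute (g0 ^+ k) s.
  have [->|s1] := pselect (s = 1); first by exists 1%N => //; apply: commute1.
  have [p [a [b [p0 e]]]] := finitely_many_cosets_pow subgroupT (cos2 s s1)
    (I : setT g0).
  exists p => //; have -> : g0 ^+ p = s ^+ 2 ^+ b * s ^+ 2 ^- a.
    by rewrite -e mulgK.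
  apply: commute_sym; apply: commuteM; last apply: commuteV.
    by rewrite -expgnA; apply: commuteX; apply: commute_refl.
  by rewrite -expgnA; apply: commuteX; apply: commute_refl.
have [k k0 kA] : exists2 k, (0 < k)%N & forall s, s \in A -> commute s (g0 ^+ k).
  elim: A {AG} => [|s A [k k0 kA]]; first by exists 1%N.
  have [l l0 ls] := comm s; exists (k * l)%N; first by rewrite muln_gt0 k0.
  move=> t; rewrite inE => /orP[/eqP->|/kA tk].
    by rewrite mulnC expgnA; apply: commuteX; apply: commute_sym.
  by rewrite expgnA; apply: commuteX.
(* Squared because [cos2] gives finite index for squares only. *)
pose z := g0 ^+ k ^+ 2.
have z1 : g0 ^+ k <> 1 by apply: Gtf.
have zC x : commute z x.
  apply: commute_sym; apply: commuteX.
  suff : generated [set` A] `<=` [set x | commute x (g0 ^+ k)].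
    by rewrite AG; apply.
  apply: generated_sub => //; split=> [|a b ka kb] /=.
    exact/commute_sym/commute1.
  by apply: commute_sym; apply: commuteM; [|apply: commuteV]; apply: commute_sym.
have [nu [nuM nuI]] := transfer_to_central_cyclic (X2 _ z1) zC (cos2 _ z1) Gtf.
exact: infinite_cyclic_of_int nuM Ginf nuI.
Qed.

End Cyclic.

(** * Projective modules over a group ring *)

Local Open Scope ring_scope.

Section FiniteSupport.
Context {I : choiceType}.

Definition finite_support_on (M : nmodType) (F : I -> M) : Prop :=
  finite_set [set i | F i <> 0].

Lemma fsumE (M : nmodType) (F : I -> M) (r : seq I) : uniq r ->
  (forall i, i \notin r -> F i = 0) ->
  \sum_(i \in [set: I]) F i = \sum_(i <- r) F i.
Proof.
move=> ur Fr; rewrite (fsbigE r) //; first by apply: eq_bigl => i; rewrite in_setT.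
by move=> i _; apply: Fr.
Qed.

Lemma finite_support_seq (M : nmodType) (F : I -> M) : finite_support_on F ->
  exists2 r : seq I, uniq r & forall i, i \notin r -> F i = 0.
Proof.
move=> /finite_seqP[r rP]; exists (undup r); first exact: undup_uniq.
move=> i; rewrite mem_undup => ir; apply: contrapT => Fi; move/negP: ir; apply.
suff : [set` r] i by [].
by rewrite -rP.
Qed.

Lemma fsum_morph (M N : nmodType) (f : M -> N) (F : I -> M) :
  f 0 = 0 -> {morph f : x y / x + y} -> finite_support_on F ->
  f (\sum_(i \in [set: I]) F i) = \sum_(i \in [set: I]) f (F i).
Proof.
move=> f0 fD /finite_support_seq[r ur Fr].
rewrite !(fsumE ur) // => [|i /Fr -> //].
exact: big_morph.
Qed.

Lemma fsum_sum (M : nmodType) (J : eqType) (s : seq J) (F : J -> I -> M) :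
  (forall j, j \in s -> finite_support_on (F j)) ->
  \sum_(j <- s) \sum_(i \in [set: I]) F j i =
  \sum_(i \in [set: I]) \sum_(j <- s) F j i.
Proof.
move=> Ffin.
have [r ur Fr] : exists2 r : seq I, uniq r &
    forall i, i \notin r -> forall j, j \in s -> F j i = 0.
  have fin : finite_set [set i | exists2 j, j \in s & F j i <> 0].
    apply: (@sub_finite_set _ _ (\bigcup_(j in [set` s]) [set i | F j i <> 0])).
      by move=> i [j js Fji]; exists j.
    exact: bigcup_finite.
  have /finite_seqP[r rP] := fin; exists (undup r); first exact: undup_uniq.
  move=> i; rewrite mem_undup => ir j js; apply: contrapT => Fi.
  move/negP: ir; apply; suff : [set` r] i by [].
  by rewrite -rP; exists j.
rewrite big_seq (eq_bigr (fun j => \sum_(i <- r) F j i)) -?big_seq; last first.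
  by move=> j js; apply: fsumE => // i /Fr; apply.
rewrite exchange_big; apply/esym/fsumE => // i /Fr Fi.
by rewrite big_seq big1.
Qed.

Lemma fsumD (M : nmodType) (F F' : I -> M) :
  finite_support_on F -> finite_support_on F' ->
  \sum_(i \in [set: I]) (F i + F' i) =
  \sum_(i \in [set: I]) F i + \sum_(i \in [set: I]) F' i.
Proof.
move=> Ff F'f.
have FF (b : bool) : b \in [:: true; false] ->
    finite_support_on (if b then F else F') by case: b.
have := fsum_sum FF; rewrite !big_cons big_nil addr0 => ->.
by apply: eq_fsbigr => i _; rewrite !big_cons big_nil addr0.
Qed.

End FiniteSupport.

Section FreeModule.
Context (R : nzRingType) (K : choiceType).

Definition free_pred : {pred K -> R^o} :=
  [pred f | `[< finite_support_on (f : K -> R^o) >]].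

Fact free_submod_closed : submod_closed free_pred.
Proof.
split=> [|a f g /asboolP ff /asboolP gf].
  by apply/asboolP; apply: sub_finite_set (finite_set0 _) => k.
apply/asboolP; apply: (@sub_finite_set _ _ ([set k | f k <> 0] `|` [set k | g k <> 0])).
  move=> k /= fg; apply: contrapT => /not_orP[/contrapT fk /contrapT gk].
  apply: fg; have -> : (a *: f + g) k = a *: f k + g k by [].
  by rewrite fk gk scaler0 addr0.
by rewrite finite_setU.
Qed.

HB.instance Definition _ :=
  GRing.isSubmodClosed.Build R (K -> R^o) free_pred free_submod_closed.

Record free_module := FreeModule {
  free_val :> K -> R^o ;
  _ : free_val \in free_pred }.

HB.instance Definition _ := [isSub for free_val].
HB.instance Definition _ := [Choice of free_module by <:].
HB.instance Definition _ := [SubChoice_isSubLmodule of free_module by <:].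

Lemma free_support (f : free_module) : finite_support_on (f : K -> R^o).
Proof. by case: f => f /= /asboolP. Qed.

Variables (M : lmodType R) (e : K -> M).

Definition free_lift (f : free_module) : M :=
  \sum_(k \in [set: K]) (f k : R) *: e k.

Fact free_scale_support (f : free_module) :
  finite_support_on (fun k => (f k : R) *: e k).
Proof.
apply: sub_finite_set (free_support f) => k /= fk fk0.
by apply: fk; rewrite fk0 scale0r.
Qed.

Fact free_lift_linear : linear free_lift.
Proof.
move=> a f g; rewrite /free_lift.
rewrite (fsum_morph (scaler0 _ a) (scalerDr a)) //; last exact: free_scale_support.
rewrite -fsumD; last exact: free_scale_support.
  by apply: eq_fsbigr => k _; rewrite scalerA -scalerDl.
apply: sub_finite_set (free_scale_support f) => k /= fk fk0.
by apply: fk; rewrite fk0 scaler0.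
Qed.

HB.instance Definition _ :=
  GRing.isLinear.Build R free_module M *:%R free_lift free_lift_linear.

Lemma free_lift_basis (k : K) : exists f, free_lift f = e k.
Proof.
pose d : K -> R^o := fun l => (l == k)%:R.
have dP : d \in free_pred.
  apply/asboolP; apply: sub_finite_set (finite_set1 k) => l /=.
  by rewrite /d; case: eqP.
exists (FreeModule dP); rewrite /free_lift (@fsumE _ _ _ [:: k]) //.
  by rewrite big_seq1 /= /d eqxx scale1r.
by move=> i; rewrite inE /= /d => /negbTE ->; rewrite scale0r.
Qed.

End FreeModule.

Section GroupRingModules.
Context {G : groupType}.
Implicit Types (g h u : G) (a : group_ring G).

Lemma gr_lift_coef (F : G -> group_ring G) a h :
  gr_lift F a h = gr_lift (fun g => F g h) a.
Proof.
apply: (@gr_lift_morph _ _ _ (fun b : group_ring G => b h)) => b b'.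
exact: gr_coefD.
Qed.

Lemma gr_elt_mul_coef g a h : (gr_elt g * a) h = a (g^-1 * h)%g.
Proof.
have -> : gr_elt g * a = gr_lift (fun u => gr_elt (g * u)%g) a.
  by rewrite [LHS]/(gr_mul _ _) /gr_mul gr_lift_elt.
rewrite -[in RHS](gr_lift_id a) !gr_lift_coef; apply: eq_gr_lift => u.
rewrite !gr_eltE; congr (nat_of_bool _)%:R; apply/eqP/eqP => [->|<-].
  by rewrite mulKg.
by rewrite mulVKg.
Qed.

Lemma gr_elt_mul g h : gr_elt g * gr_elt h = gr_elt (g * h)%g.
Proof. by rewrite [LHS]/(gr_mul _ _) /gr_mul !gr_lift_elt. Qed.

Context (M : lmodType (group_ring G)).

Lemma gr_scaleE a (m : M) : a *: m = gr_lift (fun g => gr_elt g *: m) a.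
Proof.
rewrite -{1}(gr_lift_id a); apply: (@gr_lift_morph _ _ _ (fun b => b *: m)).
by move=> b b'; rewrite scalerDl.
Qed.

Lemma gr_elt_scaleM g h (m : M) : gr_elt g *: (gr_elt h *: m) = gr_elt (g * h)%g *: m.
Proof. by rewrite scalerA gr_elt_mul. Qed.

Lemma gr_elt1_scale (m : M) : gr_elt 1%g *: m = m.
Proof. exact: scale1r. Qed.

(* The coefficient functions [c k] are those at the identity of the coordinates
   in a free module having M as a direct summand. *)
Lemma projective_dual_basis : projective M ->
  exists c : M -> M -> int, (forall k, {morph c k : x y / x + y}) /\
    forall m, finite_support_on (fun i : M * G => c i.1 (gr_elt i.2^-1%g *: m)) /\
      m = \sum_(i \in [set: M * G])
            (gr_elt i.2 *: i.1) *~ c i.1 (gr_elt i.2^-1%g *: m).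
Proof.
move=> /(_ (free_module (group_ring G) M) M (free_lift (@id M)) idfun)[].
  by move=> m; apply: free_lift_basis.
move=> h hP.
exists (fun k m => (h m k : group_ring G) 1%g); split=> [k x y|m].
  by rewrite linearD -gr_coefD.
have cE k u : (h (gr_elt u^-1%g *: m) k : group_ring G) 1%g =
    (h m k : group_ring G) u.
  rewrite linearZ; transitivity ((gr_elt u^-1%g * (h m k : group_ring G)) 1%g).
    by [].
  by rewrite gr_elt_mul_coef invgK mulg1.
have [r ur rP] := finite_support_seq (free_support (h m)).
pose U := undup (flatten [seq (finsupp (h m k : group_ring G) : seq G) | k <- r]).
pose D := [seq (k, u) | k <- r, u <- U].
have UP k u : u \notin U -> (h m k : group_ring G) u = 0.
  have [kr uU|/rP -> _] := boolP (k \in r); last exact: gr_coef0.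
  apply: fsfun_dflt; apply: contra uU => uk; rewrite mem_undup.
  by apply/flatten_mapP; exists k.
have DP i : i \notin D -> (h m i.1 : group_ring G) i.2 = 0.
  case: i => k u /= kuD; have [kr|/rP ->] := boolP (k \in r); last first.
    exact: gr_coef0.
  apply: UP; apply: contra kuD => uU; exact: allpairs_f.
have uD : uniq D by apply: allpairs_uniq; rewrite ?undup_uniq // => -[??] [??].
split.
  apply: (@sub_finite_set _ _ [set` D]) => // i /=; rewrite cE.
  by apply: contra_notT => /DP.
rewrite (fsumE uD) => [|i /DP]; last by rewrite cE => ->; rewrite mulr0z.
rewrite -[LHS](hP m) /= /free_lift (fsumE ur) => [|k /rP ->]; last exact: scale0r.
rewrite /D big_allpairs; apply: eq_bigr => k _.
rewrite gr_scaleE (@gr_lift_wide _ _ [fset u in U]%fset).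
  rewrite [LHS](perm_big U) /=; first by apply: eq_bigr => u _; rewrite cE.
  apply: uniq_perm; rewrite ?undup_uniq ?fset_uniq // => u.
  by rewrite in_fset.
apply/fsubsetP => u; rewrite in_fset mem_finsupp; apply: contraNT => /UP ->.
by [].
Qed.

End GroupRingModules.

(** * Tate cohomology of a finite cyclic subgroup *)

Section FiniteOrder.
Context {G : groupType} (g : G) (p : nat).
Hypotheses (p_gt1 : (1 < p)%N) (gp : (g ^+ p = 1)%g)
  (gmin : forall n, (0 < n)%N -> (g ^+ n = 1)%g -> (p <= n)%N).

Definition norm_map (M : lmodType (group_ring G)) (m : M) : M :=
  \sum_(i < p) gr_elt (g ^+ i)%g *: m.

(* Vanishing of the Tate cohomology of <g> with coefficients in A, in degrees 0
   and -1. *)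
Definition tate_acyclic (M : lmodType (group_ring G)) (A : set M) : Prop :=
  (forall m, A m -> gr_elt g *: m = m -> exists2 m', A m' & m = norm_map m') /\
  (forall m, A m -> norm_map m = 0 -> exists2 m', A m' & m = gr_elt g *: m' - m').

Lemma norm_map_linear (M N : lmodType (group_ring G)) (f : {linear M -> N}) m :
  f (norm_map m) = norm_map (f m).
Proof. by rewrite /norm_map linear_sum; apply: eq_bigr => i _; rewrite linearZ. Qed.

Lemma norm_mapD (M : lmodType (group_ring G)) (m m' : M) :
  norm_map (m + m') = norm_map m + norm_map m'.
Proof. by rewrite /norm_map -big_split; apply: eq_bigr => i _; rewrite scalerDr. Qed.

Lemma norm_mapN (M : lmodType (group_ring G)) (m : M) : norm_map (- m) = - norm_map m.
Proof. by rewrite /norm_map -sumrN; apply: eq_bigr => i _; rewrite scalerN. Qed.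

Lemma sum_powersS (V : zmodType) (F : G -> V) :
  \sum_(i < p) F (g ^+ i.+1)%g = \sum_(i < p) F (g ^+ i)%g.
Proof.
case: p p_gt1 gp => // q _ gq.
rewrite big_ord_recr [RHS]big_ord_recl /= gq expg0 addrC; congr (_ + _).
Qed.

Lemma sum_powersV (V : zmodType) (F : G -> V) :
  \sum_(i < p) F (g ^- i)%g = \sum_(i < p) F (g ^+ i)%g.
Proof.
rewrite -sum_powersS (reindex_inj rev_ord_inj); apply: eq_bigr => i _ /=.
congr F; apply: (mulIg (g ^+ (p - i.+1))%g).
by rewrite mulVg -expgnDr addnC subnK.
Qed.

Lemma norm_map_shift (M : lmodType (group_ring G)) (m : M) :
  gr_elt g *: norm_map m = norm_map m /\ norm_map (gr_elt g *: m) = norm_map m.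
Proof.
have e := sum_powersS (fun u => gr_elt u *: m); rewrite /norm_map; split.
  rewrite scaler_sumr -[RHS]e; apply: eq_bigr => i _.
  by rewrite gr_elt_scaleM expgS.
by rewrite -[RHS]e; apply: eq_bigr => i _; rewrite gr_elt_scaleM expgSr.
Qed.

(** Dimension shifting along 0 -> K -> M -> range f -> 0. The cohomology of a cyclic group has
    period 2, so the two degrees feed each other. *)
Lemma tate_acyclic_range (M N : lmodType (group_ring G)) (f : {linear M -> N})
    (K : set M) : (forall x, f x = 0 <-> K x) ->
  tate_acyclic [set: M] -> tate_acyclic K -> tate_acyclic (range f).
Proof.
move=> fK [M1 M2] [K1 K2]; split=> _ [x _ <-].
  move=> gfx.
  have [||y Ky xy] := K2 (gr_elt g *: x - x).
  - by apply/fK; rewrite linearB linearZ /= gfx subrr.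
  - by rewrite norm_mapD norm_mapN (norm_map_shift x).2 subrr.
  have [|z _ xyz] := M1 (x - y) I.
    apply/eqP; rewrite scalerBr -subr_eq0 opprD opprK addrACA.
    by rewrite [- _ + y]addrC -[y - _]opprB -xy subrr.
  exists (f z); first by exists z.
  by rewrite -norm_map_linear -xyz linearB (iffRL (fK y) Ky) subr0.
move=> Nfx.
have [||y Ky xy] := K1 (norm_map x).
- by apply/fK; rewrite norm_map_linear.
- exact: (norm_map_shift x).1.
have [|z _ xyz] := M2 (x - y) I.
  by rewrite norm_mapD norm_mapN xy subrr.
exists (f z); first by exists z.
have <- : f (x - y) = f x by rewrite linearB (iffRL (fK y) Ky) subr0.
by rewrite xyz linearB linearZ.
Qed.

Let rel x y := exists i, (y = g ^+ i * x)%g.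
Let rep x := xget 1%g [set y | rel x y].

Let rel_sym x y : rel x y -> rel y x.
Proof.
move=> [i ->]; exists (p * i - i)%N.
rewrite mulgA -expgnDr subnK ?expgnA ?gp ?expg1n ?mul1g //.
by rewrite leq_pmull // ltnW.
Qed.

Let rel_trans x y z : rel x y -> rel y z -> rel x z.
Proof. by move=> [i ->] [j ->]; exists (j + i)%N; rewrite expgnDr mulgA. Qed.

Let repP x : rel x (rep x).
Proof.
by apply: (@xgetPex _ 1%g [set y | rel x y]); exists x, 0%N; rewrite mul1g.
Qed.

Let rep_eq x y : rel x y -> rep x = rep y.
Proof.
move=> xy; congr xget; apply/seteqP; split=> w /=; last exact: rel_trans.
by apply: rel_trans; apply: rel_sym.
Qed.

(* {x | rep x = x} is a transversal of the right cosets of <g>. *)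
Lemma transversal_sum (V : zmodType) (v : V) x :
  \sum_(i < p) (if rep (g ^- i * x)%g == (g ^- i * x)%g then v else 0) = v.
Proof.
have gX n : (g ^+ n = g ^+ (n %% p))%g.
  by rewrite {1}(divn_eq n p) expgnDr mulnC expgnA gp expg1n mul1g.
have rg i : rep (g ^- i * x)%g = rep x.
  by apply: rep_eq; exists i; rewrite mulVKg.
have [k kx] := repP x.
have p0 : (0 < p)%N by apply: ltnW.
(* This is -k modulo p, the one index with g^-j x = g^k x = rep x. *)
pose j := Ordinal (ltn_pmod (p * k - k) p0).
have jx : (g ^- j * x)%g = rep x.
  rewrite kx; congr (_ * _)%g; rewrite /= -gX; apply: mulg1_eq.
  by rewrite -expgnDr subnK ?expgnA ?gp ?expg1n // leq_pmull.
rewrite (bigD1 j) //= rg jx eqxx big1 ?addr0 // => i ij.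
rewrite rg; case: eqP => // xi; case/eqP: ij; apply: val_inj => /=.
have /(mulIg x)/invg_inj e : (g ^- i * x = g ^- j * x)%g by rewrite -xi jx.
have aux (a b : nat) : (a < b < p)%N -> (g ^+ a <> g ^+ b)%g.
  move=> /andP[ab bp] gab; suff : (p <= b - a)%N by move: ab bp; lia.
  apply: gmin; first by rewrite subn_gt0.
  by rewrite expgnFr ?(ltnW ab) // gab mulgV.
have [ij|ji|//] := ssrnat.ltngtP i j.
  by case: (@aux i j) => //; rewrite ij ltn_pmod.
by case: (@aux j i) => //; rewrite ji ltn_ord.
Qed.

(** The identity of M is the trace over <g> of an additive map e. If g fixes m, this exhibits m as
    the norm of e m. If m has norm 0, the e (g^-j m) add up to 0, so m is the sum of the (g^j - 1) e
    (g^-j m), each of which is divisible by g - 1. *)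
Lemma tate_acyclic_projective (M : lmodType (group_ring G)) :
  projective M -> tate_acyclic [set: M].
Proof.
move=> /projective_dual_basis[c [cD cP]].
pose F (m : M) (i : M * G) := (gr_elt i.2 *: i.1) *~ c i.1 (gr_elt i.2^-1%g *: m).
have Ffin m : finite_support_on (F m).
  apply: sub_finite_set (cP m).1 => i /= Fi ci0; apply: Fi.
  by rewrite /F ci0 mulr0z.
have FE m : m = \sum_(i \in [set: M * G]) F m i := (cP m).2.
have FM u m k x : F (gr_elt u *: m) (k, x) = gr_elt u *: F m (k, (u^-1 * x)%g).
  by rewrite /F /= -scalerMzr !gr_elt_scaleM mulVKg invgM invgK.
(* [e] restricts the coordinates to a transversal of <g>; the trace of [e] over
   <g> is the identity, which is [eP]. *)
pose T (i : M * G) := rep i.2 == i.2.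
pose e m := \sum_(i \in [set: M * G]) (if T i then F m i else 0).
have eD : {morph e : m n / m + n}.
  move=> m n; rewrite -fsumD.
  - apply: eq_fsbigr => i _; case: (T i); last by rewrite addr0.
    by rewrite /F scalerDr cD mulrzDr.
  - by apply: sub_finite_set (Ffin m) => i /=; case: (T i).
  - by apply: sub_finite_set (Ffin n) => i /=; case: (T i).
have e0 : e 0 = 0 by apply: (addrI (e 0)); rewrite -eD !addr0.
have eP m : m = \sum_(j < p) gr_elt (g ^+ j)%g *: e (gr_elt (g ^- j)%g *: m).
  have step (j : 'I_p) : gr_elt (g ^+ j)%g *: e (gr_elt (g ^- j)%g *: m) =
      \sum_(i \in [set: M * G])
        (if rep (g ^- j * i.2)%g == (g ^- j * i.2)%g then F m i else 0).
    rewrite /e (fsum_morph (scaler0 _ _) (scalerDr _)); last first.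
      by apply: sub_finite_set (Ffin (gr_elt (g ^- j)%g *: m)) => i /=; case: (T i).
    rewrite (@reindex_fsbigT _ _ _ _ _ (fun i : M * G => (i.1, (g ^- j * i.2)%g))).
      apply: eq_fsbigr => -[k x] _; rewrite /T /=; case: ifP => _; last first.
        by rewrite scaler0.
      by rewrite FM gr_elt_scaleM mulgV gr_elt1_scale invgK mulVKg.
    exists (fun i : M * G => (i.1, (g ^+ j * i.2)%g)) => -[k x] /=.
      by rewrite mulVKg.
    by rewrite mulKg.
  rewrite (eq_bigr _ (fun j _ => step j)) fsum_sum; last first.
    by move=> j _; apply: sub_finite_set (Ffin m) => i /=; case: ifP.
  by rewrite {1}[m]FE; apply: eq_fsbigr => i _; rewrite transversal_sum.
have gV (m : M) j : gr_elt g *: m = m -> gr_elt (g ^- j)%g *: m = m.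
  move=> gm; elim: j => [|j IH]; first by rewrite expg0 invg1 gr_elt1_scale.
  rewrite -{1}gm gr_elt_scaleM expgS invgM -mulgA mulVg mulg1.
  exact: IH.
split=> m _.
  move=> gm; exists (e m) => //; rewrite {1}[m]eP; apply: eq_bigr => j _.
  by rewrite gV.
move=> Nm.
have e_sum : \sum_(j < p) e (gr_elt (g ^- j)%g *: m) = 0.
  rewrite -(big_morph e eD e0) (sum_powersV (fun u => gr_elt u *: m)).
  by rewrite [X in e X](_ : _ = 0) ?e0.
have tel (j : nat) (y : M) : exists z, gr_elt (g ^+ j)%g *: y = y + (gr_elt g *: z - z).
  elim: j => [|j [z IH]]; first by exists 0; rewrite expg0 gr_elt1_scale scaler0 subrr addr0.
  exists (gr_elt (g ^+ j)%g *: y + z); rewrite expgS -gr_elt_scaleM.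
  rewrite scalerDr opprD; set a := gr_elt (g ^+ j)%g *: y in IH *.
  rewrite -[LHS](addrK a) {2}IH !addrA [_ + y]addrC.
  by rewrite [RHS]addrAC.
have /choice[z zP] (j : 'I_p) := tel j (e (gr_elt (g ^- j)%g *: m)).
exists (\sum_(j < p) z j) => //.
rewrite {1}[m]eP (eq_bigr _ (fun j _ => zP j)) big_split /= e_sum add0r.
by rewrite sumrB scaler_sumr.
Qed.

End FiniteOrder.

(** Acyclicity descends the resolution from its zero terms to Z. But on the trivial module Z the
    norm of an element of order p is multiplication by p, and 1 is not a multiple of p > 1. *)
Lemma torsion_free_of_type_FP (G : groupType) : type_FP G -> @torsion_free G.
Proof.
move=> [n [P [d [eps [Pproj Pn epsS epsK dK]]]]] g g1 k k0 gk.
have [|p /andP[p0 /eqP gp] pmin] := @ex_minnP (fun p => (0 < p)%N && ((g ^+ p)%g == 1%g)).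
  by exists k; rewrite k0 gk eqxx.
have p1 : (1 < p)%N.
  rewrite ltn_neqAle p0 andbT; apply: contra_notN g1 => /eqP p1.
  by rewrite -p1 in gp.
have gmin m : (0 < m)%N -> (g ^+ m)%g = 1%g -> (p <= m)%N.
  by move=> m0 gm; apply: pmin; rewrite m0 gm eqxx.
have acP i := tate_acyclic_projective p1 gp gmin (Pproj i).1.
have range_eq (i : nat) : (forall x, d i x = 0 <-> range (d i.+1) x).
  move=> x; rewrite dK; split=> [[y <-]|[y _ <-]]; by exists y.
have ac m i : (n < i + m)%N -> tate_acyclic g p (range (d i)).
  elim: m i => [|m IH] i ni.
    rewrite addn0 in ni.
    have d0 y : d i y = 0 by have y0 := Pn i.+1 y (ltnW ni); rewrite y0 linear0.
    split=> _ [y _ <-] _; exists 0; rewrite ?d0; try (by exists 0; rewrite // linear0).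
      by rewrite /norm_map big1 // => j _; rewrite scaler0.
    by rewrite scaler0 subrr.
  apply: (tate_acyclic_range p1 gp (range_eq i)) => //.
  by apply: IH; rewrite addSnnS.
have ac0 : tate_acyclic g p (range (d 0%N)) by apply: (ac n.+1); rewrite add0n.
have [acZ _] : tate_acyclic g p (range eps).
  apply: (tate_acyclic_range p1 gp _ (acP 0%N) ac0) => x.
  by rewrite epsK; split=> [[y <-]|[y _ <-]]; exists y.
have triv u (z : trivial_int G) : gr_elt u *: z = z.
  by rewrite [LHS]/(gm_scale _ _) /gm_scale gr_lift_elt.
have [x x1] := epsS 1; have [||z _] := acZ 1.
- by exists x.
- exact: triv.
rewrite /norm_map (eq_bigr (fun=> z)) => [|i _]; last exact: triv.
rewrite sumr_const card_ord => pz; have : (1 = (z : int) * p%:Z)%R.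
  by rewrite mulrC -[p%:Z]natz mulr_natl.
move=> zp; have : (p%:Z %| 1)%Z by apply/dvdzP; exists (z : int).
by rewrite dvdz1 absz_nat => /eqP p_eq1; rewrite p_eq1 in p1.
Qed.

(** * One-endedness: cohomological criterion and transfer *)

Section OneEnded.
Context (G : groupType).
Local Notation ZG := (group_ring G).

(* Finite groups are included. *)
Definition one_ended := forall f : G -> bool,
  almost_invariant f -> almost_constant f.

(** Translates of the characteristic function v of f differ by finitely supported functions b g0 g1
    = g1.v - g0.v, so b is a 1-cocycle in ZG: the coboundary of v among all functions on G. If it is
    also the coboundary of some m in ZG, then v - m is invariant, hence constant, and v is constant
    off the support of m. *)
Lemma one_ended_of_cohomology : cohomology_trivial ZG^o 1 -> one_ended.
Proof.
move=> H1 f fI.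
pose v x : int := (f x)%:R.
pose A (g0 g1 : G) := [set x | v (g1^-1 * x)%g <> v (g0^-1 * x)%g].
have Afin g0 g1 : finite_set (A g0 g1).
  have /(ae_inj (f := fun x => (g0^-1 * x)%g) (E := setT)) := fI (g1^-1 * g0)%g.
  move=> /(_ (@mulgI _ _) (fun _ _ => I)); apply: sub_finite_set => x /= vx.
  by split=> // fx; apply: vx; rewrite /v -fx mulgA mulgK.
pose b g0 g1 : ZG := [fsfun x in fset_set (A g0 g1) =>
   v (g1^-1 * x)%g - v (g0^-1 * x)%g].
have bE g0 g1 x : b g0 g1 x = v (g1^-1 * x)%g - v (g0^-1 * x)%g.
  rewrite fsfunE in_fset_set //; case: ifPn => //.
  by rewrite notin_setE => /contrapT ->; rewrite subrr.
pose c (g : {ffun 'I_2 -> G}) : ZG^o := b (g ord0) (g (lift ord0 ord0)).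
have grP (a a' : ZG) : (forall x, a x = a' x) -> a = a'.
  by move=> e; apply/fsfunP.
have cC : is_cocycle c.
  split=> [h g|g].
    apply: grP => x; rewrite [RHS](gr_elt_mul_coef h _ x) /c !bE !ffunE.
    by rewrite !invgM !mulgA.
  rewrite /cobd; rewrite !big_ord_recl big_ord0 addr0.
  rewrite expr0 scale1r expr1 scaleN1r /bump /= expr2 mulrNN mulr1 scale1r.
  apply: grP => x; rewrite !(gr_coefD, gr_coef0) /c !ffunE.
  have gN (a : ZG) : (- a) x = - a x.
    by apply: (addrI (a x)); rewrite -gr_coefD !subrr gr_coef0.
  rewrite [X in _ + (X + _)](gN) !bE.
  have -> : lift (lift ord0 ord0) (lift ord0 ord0) = lift ord0 (lift ord0 ord0) :> 'I_3.
    exact: val_inj.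
  have -> : lift (lift ord0 (lift ord0 ord0)) (lift ord0 ord0) = lift ord0 ord0 :> 'I_3.
    exact: val_inj.
  have -> : lift (lift ord0 ord0) ord0 = ord0 :> 'I_3 by exact: val_inj.
  have -> : lift (lift ord0 (lift ord0 ord0)) ord0 = ord0 :> 'I_3 by exact: val_inj.
  by lia.
have [e [eC ce]] := H1 c cC.
have eE h : e [ffun=> h] = gr_elt h *: e [ffun=> 1%g].
  by rewrite -eC; congr e; apply/ffunP => j; rewrite !ffunE mulg1.
pose m : ZG := e [ffun=> 1%g].
have gN (a : ZG) x : (- a) x = - a x.
  by apply: (addrI (a x)); rewrite -gr_coefD !subrr gr_coef0.
have vm y : v y - v 1%g = m y - m 1%g.
  (* The pair (1, y^-1), read at the coefficient of 1, compares v y with v 1. *)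
  have := ce [ffun j : 'I_2 => if j == ord0 then 1%g else y^-1%g].
  rewrite /cobd !big_ord_recl big_ord0 addr0 expr0 scale1r /bump /= expr1 scaleN1r.
  have -> : [ffun j => [ffun j0 : 'I_2 => if j0 == ord0 then 1%g else y^-1%g]
     (lift ord0 j)] = [ffun=> y^-1%g] :> {ffun 'I_1 -> G}.
    by apply/ffunP => j; rewrite !ffunE.
  have -> : [ffun j => [ffun j0 : 'I_2 => if j0 == ord0 then 1%g else y^-1%g]
     (lift (lift ord0 ord0) j)] = [ffun=> 1%g] :> {ffun 'I_1 -> G}.
    apply/ffunP => j; rewrite !ffunE (ord1 j).
    by case: eqP => // ne; case: ne; apply: val_inj.
  move=> /(congr1 (fun a : ZG => a 1%g)).
  rewrite /c bE !ffunE /= [RHS]gr_coefD [in RHS]gN eE.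
  by rewrite [in RHS]gr_elt_mul_coef !invgK invg1 !mulg1.
exists (v 1%g - m 1%g == 1).
apply: (@sub_finite_set _ _ [set` finsupp m]) => //= x [_].
apply: contra_notT => /fsfun_dflt mx; have := vm x; rewrite mx sub0r /v.
by case: (f x); lia.
Qed.
End OneEnded.

Section OneEndedTransfer.
Local Open Scope group_scope.

(** A generator changes f on a finite set only, so f takes finitely many values. If G is infinite,
    one level set is infinite; its characteristic function is almost invariant, so the level set is
    cofinite. *)
Lemma almost_constant_of_one_ended (G : groupType) (T : Type) (f : G -> T) :
  finitely_generated_group G -> one_ended G ->
  almost_invariant f -> almost_constant f.
Proof.
move=> [A AG] oe fI; have [Gfin|Ginf] := pselect (finite_set [set: G]).
  by exists (f 1); apply: sub_finite_set Gfin.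
pose D := \bigcup_(s in [set` A]) [set x | setT x /\ f (s * x) <> f x].
have Dfin : finite_set D by apply: bigcup_finite => // s _; apply: fI.
pose W := [set f 1] `|` f @` (D `|` [set s * x | s in [set` A] & x in D]).
have Wfin : finite_set W.
  rewrite finite_setU; split; first exact: finite_set1.
  apply: finite_image; rewrite finite_setU; split=> //.
  exact: finite_image2.
have fW x : W (f x).
  apply: (@generated_ind G [set` A] [set x | W (f x)] 1 AG) => [y s Wy As|]; last by left.
  split.
    have [e|ne] := pselect (f (s * y) = f y); first by rewrite /= e.
    right; exists (s * y) => //; right; exists s => //; exists y => //.
    by exists s.
  have [e|ne] := pselect (f (s * (s^-1 * y)) = f (s^-1 * y)).
    by move: e Wy; rewrite mulVKg /= => <-.
  by right; exists (s^-1 * y) => //; left; exists s.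
have [w winf] : exists w, infinite_set (f @^-1` [set w]).
  apply: contrapT => nw; apply: Ginf.
  have := @bigcup_finite _ _ W (fun w => f @^-1` [set w]) Wfin.
  have fin w : W w -> finite_set (f @^-1` [set w]).
    by move=> _; apply: contrapT => winf; apply: nw; exists w.
  by move=> /(_ fin); apply: sub_finite_set => x _; exists (f x).
have [c fc] : almost_constant (fun x => `[< f x = w >]).
  by apply: oe => s; apply: ae_imp (fI s) => x _ ->.
exists w; case: c fc => fc; first by apply: ae_imp fc => x _ /asboolP.
by case: winf; apply: sub_finite_set fc => x /= fx; split=> // /asboolPn.
Qed.

(** Between finitely generated groups this is the Lipschitz condition for right-invariant word
    metrics. *)
Definition left_bounded (G H : groupType) (a : G -> H) : Prop :=
  forall s, exists2 B : set H, finite_set B & forall x, B (a (s * x) * (a x)^-1).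

Lemma almost_invariant_transfer (G H : groupType) (T : Type) (a : G -> H)
    (f : H -> T) :
  injective a -> left_bounded a -> almost_invariant f ->
  almost_invariant (f \o a).
Proof.
move=> aI aB fI s; have [B Bfin BP] := aB s.
have := ae_fin Bfin (fun t _ => fI t).
move=> /(ae_inj (f := a) (E := setT) aI (fun _ _ => I)).
by apply: ae_imp => x _ /= /(_ _ (BP x)); rewrite mulgVK.
Qed.

Lemma ae_transfer (G H : groupType) (a : G -> H) (b : H -> G) (P : H -> Prop) :
  cancel b a -> ae [set: G] (P \o a) -> ae [set: H] P.
Proof.
move=> bK /(ae_inj (can_inj bK) (E := setT) (fun _ _ => I)).
by apply: ae_imp => x _ /=; rewrite bK.
Qed.

(** Composition with b carries the cuts of G to cuts of H. One cut makes H virtually cyclic; all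
    cuts of H then agree up to negation, and this comparison is pulled back to G along a. *)
Lemma infinite_cyclic_of_bounded_bijection (G H : groupType) (a : G -> H)
    (b : H -> G) :
  cancel a b -> cancel b a -> left_bounded a -> left_bounded b ->
  finitely_generated_group H -> solvable_group H ->
  finitely_generated_group G -> @torsion_free G ->
  ~ one_ended G -> infinite_cyclic G.
Proof.
move=> aK bK aB bB Hfg Hsol Gfg Gtf /existsNP[f /not_implyP[fI fnc]].
have to_H (f' : G -> bool) : almost_invariant f' -> ~ almost_constant f' ->
    almost_invariant (f' \o b) /\ ~ almost_constant (f' \o b).
  move=> f'I f'nc; split; first exact: (almost_invariant_transfer (can_inj bK)).
  move=> [c fc]; apply: f'nc; exists c.
  exact: (ae_transfer (P := fun x => f' x = c) aK fc).
have [fbI fbnc] := to_H f fI fnc.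
have [g go gfin] := solvable_virtually_cyclic Hfg Hsol fbI fbnc.
apply: (infinite_cyclic_of_two_ended Gfg Gtf fI fnc) => f' f'I f'nc.
have [f'bI f'bnc] := to_H f' f'I f'nc.
have [e ef] := two_ended_of_cosets go gfin fbI f'bI fbnc f'bnc.
by exists e; apply: (ae_transfer (P := fun x => f' x = e (+) f x) aK ef).
Qed.

End OneEndedTransfer.

(** * Locally constant functions and almost projective systems *)

Section LocallyConstant.
Context {X : topologicalType}.

Definition locally_constant {T : Type} (f : X -> T) : Prop :=
  forall x, nbhs x [set y | f y = f x].

Lemma locally_constant_cst {T : Type} (t : T) : locally_constant (fun=> t).
Proof. by move=> x; apply: nearW. Qed.

Lemma locally_constant_comp {T U : Type} (h : T -> U) (f : X -> T) :
  locally_constant f -> locally_constant (fun x => h (f x)).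
Proof. by move=> fl x; apply: filterS (fl x) => y /= ->. Qed.

Lemma locally_constant_comp2 {T U V : Type} (h : T -> U -> V)
    (f : X -> T) (g : X -> U) : locally_constant f -> locally_constant g ->
  locally_constant (fun x => h (f x) (g x)).
Proof. by move=> fl gl x; apply: filterS2 (fl x) (gl x) => y /= -> ->. Qed.

Lemma locally_constant_sum (M : nmodType) (J : Type) (s : seq J)
    (F : J -> X -> M) : (forall j, locally_constant (F j)) ->
  locally_constant (fun x => \sum_(j <- s) F j x).
Proof.
move=> Fl; elim: s => [|j s IH] x.
  by apply: nearW => y; rewrite /= !big_nil.
by apply: filterS2 (Fl j x) (IH x) => y /= e1 e2; rewrite !big_cons e1 e2.
Qed.

(** Compactness is applied to the filter F of properties that hold for all sets of values above some
    finite one: near each x, a large enough set contains the values of f. *)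
Lemma locally_constant_finite {T : Type} (f : X -> T) : compact [set: X] ->
  locally_constant f -> finite_set (range f).
Proof.
move=> /compact_near_coveringP Xc fl.
pose F : set_system (set T) :=
  [set C | exists2 A0 : set T, finite_set A0 & forall A, A0 `<=` A -> C A].
have FF : Filter F.
  split; first by exists set0.
  - move=> C C' [A0 A0f A0C] [A1 A1f A1C]; exists (A0 `|` A1).
      by rewrite finite_setU.
    by move=> A; rewrite subUset => -[/A0C ? /A1C].
  - by move=> C C' CC' [A0 A0f A0C]; exists A0 => // A /A0C/CC'.
have [x _|A Afin AX] := Xc (set T) F (fun A x => A (f x)) FF.
  exists ([set y | f y = f x], [set A : set T | A (f x)]).
    split; first exact: fl.
    exists [set f x]; first exact: (finite_set1 (f x)).
    by move=> A; apply.
  by move=> [y A] [/= -> ].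
apply: sub_finite_set Afin => _ [x _ <-].
exact: (AX A (@subset_refl _ A) x I).
Qed.

Lemma continuous_discreteP {T : choiceType} (f : X -> discrete_topology T) :
  continuous f <-> locally_constant (f : X -> T).
Proof.
split=> [fc x|fl x]; last by apply/discrete_cvg; exact: (fl x).
by have /discrete_cvg := fc x.
Qed.

End LocallyConstant.

Lemma locally_constant_precomp {X Y : topologicalType} {T : Type} (h : X -> Y)
    (f : Y -> T) : continuous h -> locally_constant f ->
  locally_constant (fun x => f (h x)).
Proof. by move=> hc fl x; exact: (hc x _ (fl (h x))). Qed.

(** Functionals on C(X, Z) are maps on all integer functions; off the locally constant ones their
    values are arbitrary. *)
Definition additive_on_locally_constant {X : topologicalType}
    (c : (X -> int) -> int) : Prop :=
  forall f f', locally_constant f -> locally_constant f' ->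
    c (fun x => f x + f' x) = c f + c f'.

(* C(X,Z) = Z (+) P where P is a summand of a free module with basis I: [tau] is
   the projection to Z, [c i] the coefficient at the identity of the i-th
   coordinate, and [e i] the image of the i-th basis vector in P. *)
Record projective_coordinates (G : groupType) (X : topologicalType)
    (S : dynsys G X) (I : choiceType) (tau : (X -> int) -> int)
    (c : I -> (X -> int) -> int) (e : I -> X -> int) : Prop := {
  tauD : additive_on_locally_constant tau;
  tau1 : tau (fun=> 1) = 1;
  tau_inv : forall g f, locally_constant f -> tau (fun x => f (S g x)) = tau f;
  coordD : forall i, additive_on_locally_constant (c i);
  coord1 : forall i, c i (fun=> 1) = 0;
  coord_dual : forall i, locally_constant (e i);
  coord_fin : forall f, locally_constant f ->
    finite_support_on (fun j : I * G => c j.1 (fun x => f (S j.2 x)));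
  coordE : forall f, locally_constant f -> forall x,
    f x = tau f + \sum_(j \in [set: I * G])
      c j.1 (fun x => f (S j.2 x)) * e j.1 (S j.2^-1%g x) }.

Lemma almost_projective_coordinates (G : groupType) (X : topologicalType)
    (S : dynsys G X) : almost_projective S ->
  exists (I : choiceType) tau (c : I -> (X -> int) -> int) e,
    projective_coordinates S tau c e.
Proof.
move=> [P [Phi [Pproj [Psi PsiK PhiK] Phi1]]].
have [c [cD cP]] := projective_dual_basis Pproj.
(* Discontinuous functions get the default value 0. *)
pose toC (f : X -> int) : cts_int_module S :=
  if pselect (continuous (f : X -> discrete_topology int)) is left fc
  then (mkcts fc : cts_int X) else 0.
have toCE f x : locally_constant f -> (toC f : cts_int X) x = f x.
  move=> /continuous_discreteP fc; rewrite /toC; case: pselect => //.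
have PsiD : {morph Psi : f f' / f + f'}.
  by move=> f f'; apply: (can_inj PsiK); rewrite linearD !PhiK.
have PsiZ a : {morph Psi : f / a *: f}.
  by move=> f; apply: (can_inj PsiK); rewrite linearZ /= !PhiK.
have toCD f f' : locally_constant f -> locally_constant f' ->
    toC (fun x => f x + f' x) = toC f + toC f'.
  move=> fl f'l; apply/continuousEP => x.
  transitivity (f x + f' x); first exact/toCE/locally_constant_comp2.
  by rewrite -(toCE f x) // -(toCE f' x).
have lS g f : locally_constant f -> locally_constant (fun x => f (S g x)).
  by apply: locally_constant_precomp; apply: act_cts.
have toCZ g f : locally_constant f ->
    toC (fun x => f (S g x)) = gr_elt g^-1%g *: toC f.
  move=> fl; apply/continuousEP => x.
  have -> : gr_elt g^-1%g *: toC f = cts_int_act S g^-1%g (toC f).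
    by rewrite [LHS]/(gm_scale _ _) /gm_scale gr_lift_elt.
  transitivity (f (S g x)); first exact/toCE/lS.
  by rewrite -(toCE f) // -{1}[g]invgK.
have toC1 : toC (fun=> 1) = Phi (1, 0).
  rewrite Phi1; apply/continuousEP => x.
  by transitivity (1 : int); first exact/toCE/locally_constant_cst.
have trivE g (k : trivial_int G) : gr_elt g *: k = k.
  by rewrite [LHS]/(gm_scale _ _) /gm_scale gr_lift_elt.
exists P, (fun f => (Psi (toC f)).1), (fun k f => c k (Psi (toC f)).2),
  (fun k => (Phi (0, k) : cts_int X)).
have Psi_sum k f g : locally_constant f ->
    c k (Psi (toC (fun x => f (S g x)))).2 =
    c k (gr_elt g^-1%g *: (Psi (toC f)).2).
  by move=> fl; rewrite toCZ // PsiZ.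
split.
- by move=> f f' fl f'l; rewrite toCD // PsiD.
- by rewrite toC1 PsiK.
- by move=> g f fl; rewrite toCZ // PsiZ /= trivE.
- by move=> k f f' fl f'l; rewrite toCD // PsiD /= cD.
- move=> k; rewrite toC1 PsiK /=; apply: (addrI (c k 0)).
  by rewrite -cD !addr0.
- move=> k; apply/continuous_discreteP; exact: cts_fun.
- move=> f fl; have [fin _] := cP (Psi (toC f)).2.
  by apply: sub_finite_set fin => -[k g] /=; rewrite Psi_sum.
move=> f fl x; have [fin mE] := cP (Psi (toC f)).2.
have fE : toC f = Phi ((Psi (toC f)).1, 0) + Phi (0, (Psi (toC f)).2).
  rewrite -linearD -[LHS]PhiK; congr (Phi _).
  by case: (Psi (toC f)) => a b; congr pair; rewrite ?addr0 ?add0r.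
have -> : f x = (toC f : cts_int X) x by rewrite toCE.
pose ev (h : cts_int X) : int := h x.
pose Phi2 (m : P) : int := ev (Phi (0, m)).
have Phi2D : {morph Phi2 : m n / m + n}.
  move=> m n; rewrite /Phi2.
  have -> : (0, m + n) = (0, m) + (0, n) :> (trivial_int G * P)%type.
    by congr pair; rewrite addr0.
  by rewrite linearD.
have Phi20 : Phi2 0 = 0 by apply: (addrI (Phi2 0)); rewrite -Phi2D !addr0.
rewrite {1}fE; transitivity ((Psi (toC f)).1 + Phi2 (Psi (toC f)).2).
  by rewrite Phi1.
congr (_ + _); rewrite {1}mE fsum_morph //; last first.
  by apply: sub_finite_set fin => i /= + ci0; rewrite ci0 mulr0z.
apply: eq_fsbigr => -[k g] _ /=; rewrite Psi_sum //.
have PhiMz (m : P) (z : int) : Phi2 (m *~ z) = Phi2 m *~ z.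
  have PhiMn (n : nat) : Phi2 (m *+ n) = Phi2 m *+ n.
    by elim: n => [|n IH]; rewrite ?mulr0n // !mulrS Phi2D IH.
  case: z => n; first exact: PhiMn.
  rewrite NegzE !mulrNz; apply: (addrI (Phi2 (m *~ n.+1%:Z))).
  by rewrite -Phi2D !subrr Phi20 -[_ *~ n.+1%:Z]/(_ *+ n.+1) PhiMn subrr.
rewrite PhiMz -mulrzr intz mulrC; congr (_ * _).
rewrite /Phi2; have -> : (0, gr_elt g *: k) = gr_elt g *: (0, k)
    :> (trivial_int G * P)%type by congr pair; rewrite scaler0.
rewrite linearZ /=.
have -> : gr_elt g *: Phi (0, k) = cts_int_act S g (Phi (0, k)).
  by rewrite [LHS]/(gm_scale _ _) /gm_scale gr_lift_elt.
by [].
Qed.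

Lemma additive0 (M N : zmodType) (f : M -> N) : {morph f : x y / x + y} -> f 0 = 0.
Proof. by move=> fD; apply: (addrI (f 0)); rewrite -fD !addr0. Qed.

Lemma additiveMz (M N : zmodType) (f : M -> N) (x : M) (z : int) :
  {morph f : x y / x + y} -> f (x *~ z) = f x *~ z.
Proof.
move=> fD; have f0 := additive0 fD.
have fMn (n : nat) : f (x *+ n) = f x *+ n.
  by elim: n => [|n IH]; rewrite ?mulr0n // !mulrS fD IH.
case: z => n; first exact: fMn.
rewrite NegzE !mulrNz; apply: (addrI (f (x *~ n.+1%:Z))).
by rewrite -fD !subrr f0 -[_ *~ n.+1%:Z]/(_ *+ n.+1) fMn subrr.
Qed.

(** * Extending functionals to C(X, A) *)

Section Extension.
Context {X : topologicalType}.
Hypothesis Xc : compact [set: X].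
Variable c : (X -> int) -> int.
Hypothesis cD : additive_on_locally_constant c.

Definition indicator {T : eqType} (f : X -> T) (t : T) : X -> int :=
  fun x => (f x == t)%:R.

(* The extension of [c] to C(X, A) = C(X, Z) (x) A. *)
Definition extend {A : zmodType} (f : X -> A) : A :=
  \sum_(a \in [set: A]) a *~ c (indicator f a).

Lemma locally_constant_indicator {T : eqType} (f : X -> T) t :
  locally_constant f -> locally_constant (indicator f t).
Proof. exact: (locally_constant_comp (fun u => (u == t)%:R)). Qed.

Lemma additive_cst0 : c (fun=> 0) = 0.
Proof.
apply: (addrI (c (fun=> 0))); rewrite addr0 -cD; try exact: locally_constant_cst.
by congr c; apply/funext => x; rewrite addr0.
Qed.

Lemma additive_sum (J : Type) (s : seq J) (F : J -> X -> int) :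
  (forall j, locally_constant (F j)) ->
  c (fun x => \sum_(j <- s) F j x) = \sum_(j <- s) c (F j).
Proof.
move=> Fl; elim: s => [|j s IH].
  by rewrite big_nil -[RHS]additive_cst0; congr c; apply/funext => x; rewrite big_nil.
rewrite big_cons -IH -cD //; last exact: locally_constant_sum.
by congr c; apply/funext => x; rewrite big_cons.
Qed.

Lemma range_seq {T : eqType} (f : X -> T) : locally_constant f ->
  exists2 r : seq T, uniq r & forall x, f x \in r.
Proof.
move=> /(locally_constant_finite Xc)/finite_seqP[r rP].
exists (undup r); first exact: undup_uniq.
move=> x; rewrite mem_undup; suff : [set` r] (f x) by [].
by rewrite -rP; exists x.
Qed.

Lemma indicator_out {T : eqType} (f : X -> T) (r : seq T) t :
  (forall x, f x \in r) -> t \notin r -> c (indicator f t) = 0.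
Proof.
move=> fr tr; rewrite -[RHS]additive_cst0; congr c; apply/funext => x.
by rewrite /indicator; case: eqP tr => // <-; rewrite fr.
Qed.

Lemma extendE {A : zmodType} (f : X -> A) (r : seq A) : uniq r ->
  (forall x, f x \in r) -> extend f = \sum_(a <- r) a *~ c (indicator f a).
Proof.
by move=> ur fr; apply: fsumE => // a ar; rewrite (indicator_out fr ar) mulr0z.
Qed.

(** The sum may run over the values of any k through which the function factors. With one k serving
    several functions, additivity and naturality of [extend] can be checked term by term. *)
Lemma extend_comp {K : choiceType} {A : zmodType} (q : K -> A) (k : X -> K)
    (r : seq K) : locally_constant k -> uniq r -> (forall x, k x \in r) ->
  extend (fun x => q (k x)) = \sum_(t <- r) q t *~ c (indicator k t).
Proof.
move=> kl ur kr.
rewrite (@extendE _ _ (undup (map q r))) ?undup_uniq //; last first.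
  by move=> x; rewrite mem_undup map_f.
have step a : c (indicator (fun x => q (k x)) a) =
    \sum_(t <- r) (if q t == a then c (indicator k t) else 0).
  have -> : indicator (fun x => q (k x)) a =
      fun x => \sum_(t <- r) (if q t == a then indicator k t x else 0).
    apply/funext => x; rewrite (bigD1_seq (k x)) //= big1 => [|t /negbTE tk].
      by rewrite /indicator eqxx addr0; case: eqP.
    by rewrite /indicator [k x == t]eq_sym tk; case: ifP.
  rewrite (@additive_sum _ r (fun t x => if q t == a then indicator k t x else 0)).
    by apply: eq_bigr => t _; case: (q t == a) => //; apply: additive_cst0.
  move=> t; case: (q t == a); last exact: locally_constant_cst.
  exact: locally_constant_indicator.
rewrite (eq_bigr _ (fun a _ => congr1 (fun z => a *~ z) (step a))).
rewrite (eq_bigr (fun a => \sum_(t <- r)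
    (if q t == a then q t *~ c (indicator k t) else 0))); last first.
  move=> a _; rewrite (big_morph _ (mulrzDr a) (mulr0z a)).
  by apply: eq_bigr => t _; case: eqP => [->|_] //; rewrite mulr0z.
rewrite exchange_big [LHS]big_seq [RHS]big_seq; apply: eq_bigr => t tr.
rewrite (bigD1_seq (q t)) ?undup_uniq ?mem_undup ?map_f //= eqxx.
by rewrite big1 ?addr0 // => a /negbTE qa; rewrite eq_sym qa.
Qed.

Lemma extendD {A : zmodType} (f f' : X -> A) :
  locally_constant f -> locally_constant f' ->
  extend (fun x => f x + f' x) = extend f + extend f'.
Proof.
move=> fl f'l; pose k x := (f x, f' x).
have kl : locally_constant k by apply: locally_constant_comp2.
have [r ur kr] := range_seq kl.
rewrite (extend_comp (fun t : A * A => t.1 + t.2) kl ur kr).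
rewrite (extend_comp (fun t : A * A => t.1) kl ur kr).
rewrite (extend_comp (fun t : A * A => t.2) kl ur kr) -big_split.
by apply: eq_bigr => t _; rewrite mulrzDl.
Qed.

Lemma extend_morph {A B : zmodType} (h : A -> B) (f : X -> A) :
  {morph h : x y / x + y} -> locally_constant f ->
  extend (fun x => h (f x)) = h (extend f).
Proof.
move=> hD fl; have [r ur fr] := range_seq fl.
rewrite (extend_comp h fl ur fr) (extendE ur fr).
rewrite (big_morph h hD (additive0 hD)); apply: eq_bigr => a _.
by rewrite additiveMz.
Qed.

Lemma extend_cst {A : zmodType} (a : A) : extend (fun=> a) = a *~ c (fun=> 1).
Proof.
have kl : locally_constant (fun _ : X => tt) by apply: locally_constant_cst.
rewrite (@extend_comp _ _ (fun=> a) (fun=> tt) [:: tt] kl) ?big_seq1 //.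
Qed.

End Extension.

(** * Cocycles up to constants in C(X, A) *)

Section Rigidity.
Context {G : groupType} {X : topologicalType} {S : dynsys G X}.
Context {I : choiceType} {tau : (X -> int) -> int} {c : I -> (X -> int) -> int}
  {e : I -> X -> int}.
Hypotheses (Gfg : finitely_generated_group G) (Goe : one_ended G)
  (Xc : compact [set: X]) (C : projective_coordinates S tau c e).
Context {A : zmodType} {rho : G -> A -> A}.
Hypotheses (rhoD : forall g, {morph rho g : x y / x + y})
  (rho1 : forall a, rho 1%g a = a)
  (rhoM : forall g h a, rho (g * h)%g a = rho g (rho h a)).

(** The coordinates of the component of F in P (x) A: [hat F (i, u)] belongs to the translate of the
    basis vector i by u. *)
Let hat (F : X -> A) (j : I * G) : A := extend (c j.1) (fun x => F (S j.2 x)).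

Let lS {T : Type} g (F : X -> T) :
  locally_constant F -> locally_constant (fun x => F (S g x)).
Proof. by apply: locally_constant_precomp; apply: act_cts. Qed.

Let hatE F r : locally_constant F -> uniq r -> (forall x, F x \in r) ->
  forall j, hat F j = \sum_(a <- r) a *~ c j.1 (fun x => indicator F a (S j.2 x)).
Proof.
by move=> Fl ur Fr j; rewrite /hat (extendE (coordD C j.1) ur).
Qed.

Let hat_fin F : locally_constant F -> finite_support_on (hat F).
Proof.
move=> Fl; have [r ur Fr] := range_seq Xc Fl.
have := @bigcup_finite _ _ [set` r] (fun a => [set j : I * G |
  c j.1 (fun x => indicator F a (S j.2 x)) <> 0]) (finite_seq r).
have fin a : [set` r] a -> finite_set [set j : I * G |
    c j.1 (fun x => indicator F a (S j.2 x)) <> 0].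
  by move=> _; apply: (coord_fin C); apply: locally_constant_indicator.
move=> /(_ fin); apply: sub_finite_set => j; rewrite /= (hatE Fl ur Fr) => Fj.
apply: contrapT => nj; apply: Fj; rewrite big_seq big1 // => a ar.
rewrite [X in _ *~ X](_ : _ = 0) ?mulr0z //; apply: contrapT => cj.
by apply: nj; exists a.
Qed.

Let hat_recover F x : locally_constant F ->
  F x = extend tau F + \sum_(j \in [set: I * G]) hat F j *~ e j.1 (S j.2^-1%g x).
Proof.
move=> Fl; have [r ur Fr] := range_seq Xc Fl.
have -> : F x = \sum_(a <- r) a *~ indicator F a x.
  rewrite (bigD1_seq (F x)) //= big1 => [|a /negbTE aF].
    by rewrite /indicator eqxx addr0.
  by rewrite /indicator eq_sym aF.
have Il a : locally_constant (indicator F a).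
  exact: locally_constant_indicator.
have fin a : finite_support_on (fun j : I * G =>
    c j.1 (fun x => indicator F a (S j.2 x)) * e j.1 (S j.2^-1%g x)).
  apply: sub_finite_set (coord_fin C (Il a)) => j /= + cj0.
  by rewrite cj0 mul0r.
rewrite (eq_bigr _ (fun a _ => congr1 (fun z => a *~ z) (coordE C (Il a) x))).
rewrite (eq_bigr _ (fun a _ => mulrzDr a _ _)) big_split /=.
rewrite (extendE (tauD C) ur Fr); congr (_ + _).
under eq_bigr => a _ do
  rewrite (fsum_morph (f := fun z => a *~ z) (mulr0z a) (mulrzDr a) (fin a)).
rewrite fsum_sum; last first.
  by move=> a _; apply: sub_finite_set (fin a) => j /= + cj0; rewrite cj0 mulr0z.
apply: eq_fsbigr => j _; rewrite (hatE Fl ur Fr).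
set n := e j.1 _; have nD : {morph (fun z : A => z *~ n) : y z / y + z}.
  by move=> y z; rewrite mulrzDl.
rewrite (big_morph (fun z : A => z *~ n) nD (mul0rz _ n)).
by apply: eq_bigr => a _; rewrite mulrzA.
Qed.

(** Constants have zero coordinates, so [hat] turns f into a genuine cocycle of finitely supported
    functions on I * G. It has the primitive psi, up to the twist by rho; subtracting from each psi
    i its almost everywhere value m i makes the primitive finitely supported, and w is the function
    with these coordinates. *)
Lemma cocycle_coboundary (f : G -> X -> A) :
  (forall g, locally_constant (f g)) ->
  (forall g h, exists k, forall x,
     f (g * h)%g x = f g x + rho g (f h (S g^-1%g x)) + k) ->
  exists w : X -> A, locally_constant w /\
    forall g, exists k, forall x, f g x = k + w x - rho g (w (S g^-1%g x)).
Proof.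
move=> fl fM.
have rho0 g : rho g 0 = 0 by apply: additive0.
have rhoN g a : rho g (- a) = - rho g a.
  by apply: (addrI (rho g a)); rewrite -rhoD !subrr rho0.
have rhoK g a : rho g^-1%g (rho g a) = a by rewrite -rhoM mulVg rho1.
have hatM g h i u : hat (f (g * h)%g) (i, u) =
    hat (f g) (i, u) + rho g (hat (f h) (i, (g^-1 * u)%g)).
  have [k kP] := fM g h.
  have l1 : locally_constant (fun x => f g (S u x)) by apply: lS.
  have l2' : locally_constant (fun x => f h (S (g^-1 * u)%g x)) by apply: lS.
  have l2 : locally_constant (fun x => rho g (f h (S (g^-1 * u)%g x))).
    exact: (locally_constant_comp (rho g)).
  rewrite /hat /=.
  have -> : (fun x => f (g * h)%g (S u x)) =
      (fun x => (f g (S u x) + rho g (f h (S (g^-1 * u)%g x))) + k).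
    by apply/funext => x; rewrite kP actM.
  rewrite (extendD Xc (coordD C i)); try exact: locally_constant_cst.
    rewrite (extend_cst (coordD C i)) (coord1 C) mulr0z addr0.
    rewrite (extendD Xc (coordD C i)) //; congr (_ + _).
    by rewrite (extend_morph Xc (coordD C i)).
  exact: (locally_constant_comp2 +%R).
(* Evaluating the i-th coordinate of [f u] at u itself solves the cocycle
   equation without finite support; applying rho u^-1 untwists the action. *)
pose psi i u := rho u^-1%g (hat (f u) (i, u)).
have psiE g i u : rho u^-1%g (hat (f g) (i, u)) = psi i u - psi i (g^-1 * u)%g.
  have := hatM g (g^-1 * u)%g i u; rewrite mulVKg /psi => ->.
  by rewrite rhoD invgM invgK rhoM addrK.
have psi_fin g : finite_set [set j : I * G | psi j.1 (g^-1 * j.2)%g <> psi j.1 j.2].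
  apply: sub_finite_set (hat_fin (fl g)) => -[i u] /= ne h0; apply: ne.
  by apply/eqP; rewrite eq_sym -subr_eq0 -psiE h0 rho0.
(* When G is finite, every m is an almost everywhere value. The second clause makes phi vanish over
   each i for which psi i is constant, as finite support over I requires. *)
have /choice[m mP] i : exists m, ae [set: G] (fun u => psi i u = m) /\
    ((forall u, psi i u = psi i 1%g) -> forall u, psi i u = m).
  have [cst|ncst] := pselect (forall u, psi i u = psi i 1%g).
    exists (psi i 1%g); split=> //; apply: sub_finite_set (finite_set0 G).
    by move=> u [_ /(_ (cst u))].
  have [|m mP] := @almost_constant_of_one_ended G A (psi i) Gfg Goe; last first.
    by exists m; split.
  move=> s; have : finite_set ((fun j : I * G => j.2) @`
      [set j : I * G | psi j.1 (s^-1^-1 * j.2)%g <> psi j.1 j.2]).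
    by apply: finite_image; apply: psi_fin.
  by apply: sub_finite_set => u [_ ne]; exists (i, u) => //=; rewrite invgK.
pose phi (j : I * G) := rho j.2 (psi j.1 j.2 - m j.1).
have phi_fin : finite_support_on phi.
  have [A0 A0G] := Gfg.
  (* The finitely many i for which some generator changes psi i; for all others psi i is
     constant. *)
  pose I0 := \bigcup_(s in [set` A0]) ((fun j : I * G => j.1) @`
     [set j : I * G | psi j.1 (s^-1^-1 * j.2)%g <> psi j.1 j.2]).
  have I0fin : finite_set I0.
    by apply: bigcup_finite => // s _; apply: finite_image; apply: psi_fin.
  have := @bigcup_finite _ _ I0 (fun i => pair i @` [set u | setT u /\ psi i u <> m i])
    I0fin (fun i _ => finite_image _ (mP i).1).
  apply: sub_finite_set => -[i u] /= phiu.
  have pu : psi i u <> m i.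
    by move=> pu; apply: phiu; rewrite /phi /= pu subrr rho0.
  exists i; last by exists u.
  apply: contrapT => iI0; apply: pu; apply: (mP i).2.
  apply: (@generated_ind G [set` A0] [set u | psi i u = psi i 1%g] 1%g A0G) => //.
  have inv s v : s \in A0 -> psi i (s * v)%g = psi i v.
    move=> sA; apply: contrapT => ne; apply: iI0; exists s => //.
    by exists (i, v) => //=; rewrite invgK.
  move=> v s /= pv As; split; first by rewrite inv.
  by rewrite -[LHS](inv s) // mulVKg.
have phiE g i u : phi (i, u) - rho g (phi (i, (g^-1 * u)%g)) = hat (f g) (i, u).
  rewrite /phi /= -[RHS](rhoK u^-1%g) invgK psiE -rhoM mulVKg -rhoN -rhoD.
  by congr (rho u _); rewrite opprB addrA subrK.
pose w x := \sum_(j \in [set: I * G]) phi j *~ e j.1 (S j.2^-1%g x).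
have [r ur rP] := finite_support_seq phi_fin.
have w_fin x : finite_support_on (fun j => phi j *~ e j.1 (S j.2^-1%g x)).
  by apply: sub_finite_set phi_fin => j /= + p0; rewrite p0 mul0rz.
exists w; split.
  have -> : w = fun x => \sum_(j <- r) phi j *~ e j.1 (S j.2^-1%g x).
    by apply/funext => x; apply: fsumE => // j /rP ->; rewrite mul0rz.
  apply: locally_constant_sum => j.
  apply: (locally_constant_comp (fun z => phi j *~ z)).
  by apply: lS; apply: coord_dual C _.
move=> g; exists (extend tau (f g)) => x.
rewrite {1}(hat_recover x (fl g)) -addrA; congr (_ + _).
have -> : rho g (w (S g^-1%g x)) = \sum_(j \in [set: I * G])
    rho g (phi (j.1, (g^-1 * j.2)%g)) *~ e j.1 (S j.2^-1%g x).
  rewrite /w (fsum_morph (rho0 g) (rhoD g) (w_fin _)).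
  rewrite (@reindex_fsbigT _ _ _ _ _ (fun j : I * G => (j.1, (g^-1 * j.2)%g))).
    apply: eq_fsbigr => -[i u] _ /=; rewrite additiveMz //.
    by rewrite -actM invgM invgK mulgK.
  exists (fun j : I * G => (j.1, (g * j.2)%g)) => -[i u] /=.
    by rewrite mulVKg.
  by rewrite mulKg.
have phiE' j : phi j = hat (f g) j + rho g (phi (j.1, (g^-1 * j.2)%g)).
  by case: j => i u; rewrite -phiE subrK.
apply/eqP; rewrite eq_sym subr_eq -fsumD.
- by apply/eqP/eq_fsbigr => j _; rewrite {1}phiE' mulrzDl.
- by apply: sub_finite_set (hat_fin (fl g)) => j /= + h0; rewrite h0 mul0rz.
apply: (@sub_finite_set _ _ ([set j | phi j <> 0] `|` [set j | hat (f g) j <> 0])).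
  move=> j /= rj; apply: contrapT => /not_orP[/contrapT pj /contrapT hj].
  by apply: rj; have := phiE' j; rewrite pj hj add0r => <-; rewrite mul0rz.
by rewrite finite_setU; split=> //; apply: hat_fin.
Qed.

End Rigidity.

(** * Cocycles with values in a solvable group *)

Section AbelianQuotient.
Local Open Scope group_scope.
Context {H : groupType} (K L : set H).
Hypotheses (sK : is_subgroup K) (sL : is_subgroup L) (LK : L `<=` K)
  (KL : forall x y, K x -> K y -> L [~ x, y]).

Let rep x := xget 1 [set y | K y /\ L (x * y^-1)].

Let repP x : K x -> K (rep x) /\ L (x * (rep x)^-1).
Proof.
move=> Kx; apply: (@xgetPex _ 1 [set y | K y /\ L (x * y^-1)]).
by exists x; split=> //; rewrite mulgV; apply: subgroup1.
Qed.

Let rep_eq x y : L (x * y^-1) -> rep x = rep y.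
Proof.
have aux z t w : L (z * t^-1) -> L (z * w^-1) -> L (t * w^-1).
  move=> zt zw; have := sL.2 _ _ (subgroupV sL zt) (subgroupV sL zw).
  by rewrite invgK invgM invgK mulgA mulgVK.
move=> xy; congr xget; apply/seteqP; split=> w /= [Kw]; split=> //.
  exact: aux xy _.
apply: (aux y) => //; rewrite -[_ * _]invgK invgM invgK; exact: subgroupV.
Qed.

Let qP : {pred H} := fun x => `[< K x /\ rep x = x >].

(** K/L as the set of values of [rep] on K, one chosen representative for each coset. *)
Definition abelian_quotient := {x : H | qP x}.
HB.instance Definition _ := Choice.on abelian_quotient.

Let rep_qP x : K x -> qP (rep x).
Proof.
move=> /repP[Kr Lr]; apply/asboolP; split=> //; apply: rep_eq.
by rewrite -[_ * _]invgK invgM invgK; apply: subgroupV.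
Qed.

Definition aq_pi (x : H) : abelian_quotient :=
  insubd (Sub (rep 1) (rep_qP (subgroup1 sK)) : abelian_quotient) (rep x).

Let val_pi x : K x -> val (aq_pi x) = rep x.
Proof. by move=> Kx; rewrite val_insubd rep_qP. Qed.

Let valK (u : abelian_quotient) : K (val u) /\ aq_pi (val u) = u.
Proof.
have /asboolP[Ku ru] := valP u; split=> //; apply: val_inj.
by rewrite val_pi.
Qed.

Lemma aq_pi_eq x y : K x -> K y -> aq_pi x = aq_pi y <-> L (x * y^-1).
Proof.
move=> Kx Ky; split=> [/(congr1 val)|xy]; last by apply: val_inj; rewrite !val_pi ?(rep_eq xy).
rewrite !val_pi // => rxy; have [_ Lx] := repP Kx; have [_ Ly] := repP Ky.
by have := sL.2 _ _ Lx Ly; rewrite rxy invgM invgK mulgA mulgVK.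
Qed.

Definition aq_zero := aq_pi 1.
Definition aq_opp (u : abelian_quotient) := aq_pi (val u)^-1.
Definition aq_add (u v : abelian_quotient) := aq_pi (val u * val v).

Let comm x y : K x -> K y -> L (x * y * x^-1 * y^-1).
Proof.
move=> Kx Ky; have := KL (subgroupV sK Kx) (subgroupV sK Ky).
by rewrite commgEl conjgE !invgK !mulgA.
Qed.

Let addE x y : K x -> K y -> aq_add (aq_pi x) (aq_pi y) = aq_pi (x * y).
Proof.
move=> Kx Ky; rewrite /aq_add !val_pi //.
have [Krx Lx] := repP Kx; have [Kry Ly] := repP Ky.
apply/esym/aq_pi_eq; try exact: subgroupM.
(* Moving l = y (rep y)^-1 across x costs a commutator of x and l, which lies in L. *)
have -> : x * y * (rep x * rep y)^-1 =
   (x * (y * (rep y)^-1) * x^-1 * (y * (rep y)^-1)^-1) *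
   ((y * (rep y)^-1) * (x * (rep x)^-1)).
  by rewrite !invgM !invgK !mulgA !(mulgVK, mulgK).
apply: subgroupM => //; last exact: subgroupM.
by apply: comm => //; apply: LK.
Qed.

Let onpi (P : abelian_quotient -> Prop) :
  (forall x, K x -> P (aq_pi x)) -> forall u, P u.
Proof. by move=> PK u; have [Ku <-] := valK u; apply: PK. Qed.

Fact aq_addA : associative aq_add.
Proof.
elim/onpi => x Kx; elim/onpi => y Ky; elim/onpi => z Kz.
by rewrite !addE ?mulgA //; apply: subgroupM.
Qed.

Fact aq_addC : commutative aq_add.
Proof.
elim/onpi => x Kx; elim/onpi => y Ky; rewrite !addE //.
apply/aq_pi_eq; try exact: subgroupM.
by rewrite invgM mulgA; apply: comm.
Qed.

Fact aq_add0 : left_id aq_zero aq_add.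
Proof. by elim/onpi => x Kx; rewrite addE ?mul1g //; apply: subgroup1. Qed.

Fact aq_addN : left_inverse aq_zero aq_opp aq_add.
Proof.
move=> u; have [Ku {2}<-] := valK u.
by rewrite /aq_opp addE ?mulVg //; apply: subgroupV.
Qed.

HB.instance Definition _ := GRing.isZmodule.Build abelian_quotient
  aq_addA aq_addC aq_add0 aq_addN.

Lemma abelian_quotient_spec : exists (A : zmodType) (q : H -> A),
  [/\ forall x y, K x -> K y -> q (x * y) = (q x + q y)%R,
      forall x, K x -> q x = 0%R <-> L x &
      forall a, exists2 x, K x & q x = a].
Proof.
exists abelian_quotient, aq_pi; split=> [x y Kx Ky|x Kx|u].
- by rewrite -addE.
- have := aq_pi_eq Kx (subgroup1 sK); rewrite invg1 mulg1; exact.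
- by have [Ku e] := valK u; exists (val u).
Qed.

End AbelianQuotient.

Section CocycleRigidity.
Local Open Scope group_scope.
Context {G H : groupType} {X : topologicalType} {S : dynsys G X}.
Context {I : choiceType} {tau : (X -> int) -> int} {c : I -> (X -> int) -> int}
  {e : I -> X -> int}.
Hypotheses (Gfg : finitely_generated_group G) (Goe : one_ended G)
  (Xc : compact [set: X]) (C : projective_coordinates S tau c e).

Definition cocycle (a : G -> X -> H) : Prop :=
  (forall g, locally_constant (a g)) /\
  forall g h x, a (g * h) x = a g (S h x) * a h x.

Definition twist (u : X -> H) (a : G -> X -> H) g x := (u (S g x))^-1 * a g x * u x.

Lemma cocycle_twist u a : locally_constant u -> cocycle a -> cocycle (twist u a).
Proof.
move=> ul [al aM]; split=> [g|g h x]; last first.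
  by rewrite /twist actM aM !mulgA mulgK.
apply: (locally_constant_comp2 (fun y z => y * z)) => //.
apply: (locally_constant_comp2 (fun y z => y^-1 * z)) => //.
exact: locally_constant_precomp (@act_cts _ _ S g) ul.
Qed.

(* Conjugation by [a g x0] makes K/L a G-module, and [a g x * (a g x0)^-1] is a
   1-cocycle up to constants with values in C(X, K/L). *)
Lemma cocycle_twist_step (a : G -> X -> H) (K L : set H) (x0 : X) :
  is_subgroup K -> is_subgroup L -> normal K -> normal L -> L `<=` K ->
  (forall x y, K x -> K y -> L [~ x, y]) -> cocycle a ->
  (forall g x y, K (a g x * (a g y)^-1)) ->
  exists u, locally_constant u /\
    forall g x y, L (twist u a g x * (twist u a g y)^-1).
Proof.
move=> sK sL nK nL LK KL [al aM] aK.
have [A [q [qM qL qS]]] := abelian_quotient_spec sK sL LK KL.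
have q1 : q 1 = 0%R by apply/qL; apply: subgroup1.
have qV x : K x -> q x^-1 = (- q x)%R.
  move=> Kx; apply: (addrI (q x)); rewrite -qM ?mulgV ?subrr //.
  exact: subgroupV.
have /choice[s sP] v : exists x, K x /\ q x = v.
  by have [x Kx xv] := qS v; exists x.
pose t g := a g x0.
have KJ x z : K z -> K (x * z * x^-1).
  by move=> Kz; have := nK _ x^-1 Kz; rewrite conjgE invgK mulgA.
pose rho g v := q (t g * s v * (t g)^-1).
have qJ y x z : K x -> K z -> q x = q z -> q (y * x * y^-1) = q (y * z * y^-1).
  move=> Kx Kz xz; have Lxz : L (x * z^-1).
    apply/qL; first exact: sK.2.
    by rewrite qM ?qV // ?xz ?subrr //; apply: subgroupV.
  have := nL _ y^-1 Lxz; rewrite conjgE invgK => Ly.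
  have e0 : q (y * (x * z^-1 * y^-1)) = 0%R by apply/qL => //; apply: LK.
  have -> : y * x * y^-1 = y * (x * z^-1 * y^-1) * (y * z * y^-1).
    by rewrite !mulgA !mulgVK.
  by rewrite qM ?e0 ?add0r //; [apply: LK | apply: KJ].
have rhoE g x : K x -> rho g (q x) = q (t g * x * (t g)^-1).
  by move=> Kx; have [Ks qs] := sP (q x); apply: qJ.
have rhoD g : {morph rho g : v w / (v + w)%R}.
  move=> v w; have [[Kv qv] [Kw qw]] := (sP v, sP w).
  rewrite -{1}qv -{1}qw -qM // rhoE; last exact: subgroupM.
  rewrite -qM; try exact: KJ.
  by rewrite !mulgA mulgVK.
have a1 x : a 1 x = 1.
  by apply: (mulgI (a 1 x)); have := aM 1 1 x; rewrite act1 !mulg1.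
have rho1 v : rho 1 v = v.
  by have [_ qs] := sP v; rewrite /rho /t a1 mul1g invg1 mulg1.
have tM g h : K (t g * t h * (t (g * h))^-1).
  rewrite /t aM invgM mulgA mulgK -[_ * _]invgK invgM invgK.
  by apply: subgroupV.
(* Modulo K, t is multiplicative, and the defect k in K acts trivially by conjugation because K/L is
   abelian. *)
have rhoM g h v : rho (g * h) v = rho g (rho h v).
  have [Kv qv] := sP v; rewrite [in RHS]/rho -/(rho g _) rhoE; last exact: KJ.
  have -> : t g * (t h * s v * (t h)^-1) * (t g)^-1 =
     (t g * t h * (t (g * h))^-1) * (t (g * h) * s v * (t (g * h))^-1) *
     (t g * t h * (t (g * h))^-1)^-1.
    by rewrite !invgM !invgK !mulgA !mulgVK.
  set k := t g * t h * _; set m := t (g * h) * s v * _.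
  have Kk : K k by apply: tM.
  have Km : K m by apply: KJ.
  rewrite (qM (k * m)) ?(qM k m) ?qV //; [|exact: subgroupM|exact: subgroupV].
  by rewrite addrAC subrr add0r.
pose F g x := a g x * (t g)^-1.
have KF g x : K (F g x) by apply: aK.
(* The shift by g^-1 turns the cocycle identity of a into the one for the diagonal action on C(X,
   K/L). *)
pose f g x := q (F g (S g^-1 x)).
have fl g : locally_constant (f g).
  apply: (locally_constant_comp (fun y => q (y * (t g)^-1))).
  exact: locally_constant_precomp (@act_cts _ _ S g^-1) (al g).
have [|w [wl wP]] := cocycle_coboundary Gfg Goe Xc C rhoD rho1 rhoM fl.
  move=> g h; exists (q (t g * t h * (t (g * h))^-1)) => x.
  rewrite /f rhoE // -!qM //; try exact: KJ; last first.
    by apply: subgroupM => //; apply: KJ.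
  congr q; rewrite /F aM -!actM !invgM.
  by rewrite !mulgA !mulgVK mulgV mul1g.
(* The twist by the lift s (w x) of w to K equals E x * t g, and the equation for w says that E x
   has the constant class k in K/L. *)
exists (fun x => s (w x)); split; first exact: (locally_constant_comp s).
move=> g; have [k kP] := wP g.
pose E x := (s (w (S g x)))^-1 * F g x * (t g * s (w x) * (t g)^-1).
have KE x : K (E x).
  apply: subgroupM => //; last by apply: KJ; apply: (sP _).1.
  by apply: subgroupM => //; apply: subgroupV => //; apply: (sP _).1.
have qE x : q (E x) = k.
  have Ks v : K (s v) := (sP v).1.
  have KV v : K (s v)^-1 by apply: subgroupV.
  rewrite /E (qM (_ * _)); [|by apply: subgroupM|exact: KJ].
  rewrite (qM (s _)^-1) // qV // (sP _).2 -/(rho g (w x)).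
  have := kP (S g x); rewrite /f -!actM mulVg act1 => ->.
  by rewrite addrA subrK addrC addrK.
have tE x : twist (fun x => s (w x)) a g x = E x * t g.
  by rewrite /twist /E /F !mulgA !mulgVK.
move=> x y; rewrite !tE invgM mulgA mulgK; apply/qL; first exact: sK.2.
by rewrite qM ?qV ?qE ?subrr //; apply: subgroupV.
Qed.

Lemma cocycle_trivial (a : G -> X -> H) (x0 : X) : solvable_group H -> cocycle a ->
  exists u, locally_constant u /\ forall g x y, twist u a g x = twist u a g y.
Proof.
move=> [d Hd] aC.
suff [u [ul uP]] : exists u, locally_constant u /\
    forall g x y, derived_series d (twist u a g x * (twist u a g y)^-1).
  exists u; split=> // g x y; apply: divg1_eq.
  by have := uP g x y; rewrite Hd.
elim: d {Hd} => [|d [u [ul uP]]].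
  by exists (fun=> 1); split=> //; apply: locally_constant_cst.
have [v [vl vP]] := cocycle_twist_step x0 (derived_subgroup d)
  (derived_subgroup d.+1) (@derived_normal _ d) (@derived_normal _ d.+1)
  (@derivedS _ d) (@derived_commg _ d) (cocycle_twist ul aC) uP.
exists (fun x => u x * v x); split; first exact: (locally_constant_comp2 (fun y z => y * z)).
move=> g x y; have tE z : twist (fun x => u x * v x) a g z = twist v (twist u a) g z.
  by rewrite /twist invgM !mulgA.
by rewrite !tE.
Qed.

End CocycleRigidity.

(** * From trivial cocycles to conjugacies *)

Lemma continuous_act_locally_constant (G : groupType) (X Y : topologicalType)
    (S : dynsys G X) (k : Y -> G) (f : Y -> X) :
  locally_constant k -> continuous f -> continuous (fun y => S (k y) (f y)).
Proof.
move=> kl fc y.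
have /(_ y) Sc : continuous (fun z => S (k y) (f z)).
  by move=> z; apply: continuous_comp; [apply: fc | apply: act_cts].
apply: cvg_trans Sc; apply: near_eq_cvg.
by apply: filterS (kl y) => z /= ->.
Qed.

Lemma locally_constant_dep {X : topologicalType} {T U : Type} (k : X -> T)
    (F : T -> X -> U) : locally_constant k -> (forall t, locally_constant (F t)) ->
  locally_constant (fun x => F (k x) x).
Proof. by move=> kl Fl x; apply: filterS2 (kl x) (Fl (k x) x) => y /= -> ->. Qed.

(** * The projection to Z as an invariant measure *)

Section InvariantFunctional.
Context {G : groupType} {X : topologicalType} {S : dynsys G X}.
Context {I : choiceType} {tau : (X -> int) -> int} {c : I -> (X -> int) -> int}
  {e : I -> X -> int}.
Hypotheses (Xc : compact [set: X]) (C : projective_coordinates S tau c e).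

Lemma coordinates_inhabited : exists x : X, True.
Proof.
apply: contrapT => nX; have := tau1 C.
have -> : (fun _ : X => 1 : int) = (fun=> 0).
  by apply/funext => x; case: nX; exists x.
by rewrite (additive_cst0 (tauD C)).
Qed.

(** The map x |-> S (k x) x translates each piece {k = g} by g. By injectivity the translated pieces
    are disjoint, so by invariance the image has the measure of X. *)
Lemma tau_range_injective (k : X -> G) : locally_constant k ->
  injective (fun x => S (k x) x) ->
  tau (fun x => (`[< exists z, x = S (k z) z >])%:R) = 1.
Proof.
move=> kl kI; have [r ur kr] := range_seq Xc kl.
pose F g x : int := indicator k g (S g^-1%g x).
have Fl g : locally_constant (F g).
  apply: (@locally_constant_precomp _ _ _ (S g^-1%g)); first exact: act_cts.
  exact: locally_constant_indicator.
have -> : (fun x => (`[< exists z, x = S (k z) z >])%:R) =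
    fun x => \sum_(g <- r) F g x.
  apply/funext => x; case: asboolP => [[z ->]|nz].
    rewrite (bigD1_seq (k z)) //= big1 => [|g gk].
      by rewrite /F /indicator -actM mulVg act1 eqxx addr0.
    rewrite /F /indicator; case: eqP => // kg; case/eqP: gk.
    have /kI e1 : S (k (S g^-1%g (S (k z) z))) (S g^-1%g (S (k z) z)) = S (k z) z.
      by rewrite kg -actM mulgV act1.
    by rewrite -kg e1.
  rewrite big1 // => g _; rewrite /F /indicator; case: eqP => // kg; case: nz.
  by exists (S g^-1%g x); rewrite kg -actM mulgV act1.
rewrite (additive_sum (tauD C)) //.
rewrite (eq_bigr (fun g => tau (indicator k g))) => [|g _]; last first.
  apply: (tau_inv C g^-1%g); exact: locally_constant_indicator.
rewrite -(additive_sum (tauD C)) => [|g]; last exact: locally_constant_indicator.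
rewrite -(tau1 C); congr tau; apply/funext => x.
rewrite (bigD1_seq (k x)) //= big1 => [|g gk].
  by rewrite /indicator eqxx addr0.
by rewrite /indicator eq_sym (negbTE gk).
Qed.

(* The points of each F-orbit minimizing [u] form a fundamental domain E, and
   1 = #|F| * tau 1_E. *)
Lemma finite_free_subgroup_trivial (F : set G) (u : X -> nat) :
  is_subgroup F -> finite_set F -> locally_constant u ->
  (forall g x, F g -> u (S g x) = u x -> g = 1%g) -> F `<=` [set 1%g].
Proof.
move=> sF /finite_seqP[r0 r0P] ul uF; pose r := undup r0.
have rF g : g \in r <-> F g by rewrite mem_undup r0P.
have ur : uniq r := undup_uniq r0.
pose E x : bool := all (fun g => u x <= u (S g x))%N r.
have El : locally_constant E.
  rewrite /E; elim: (r) => [|g s IH]; first exact: locally_constant_cst.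
  apply: (locally_constant_comp2 andb) => //.
  apply: (locally_constant_comp2 leq) => //.
  exact: locally_constant_precomp (@act_cts _ _ S g) ul.
have E1 x : \sum_(g <- r) (E (S g x))%:R = 1 :> int.
  have [|n /hasP[g gr /eqP gn] nmin] :=
    @ex_minnP (fun n => has (fun g => u (S g x) == n) r).
    exists (u (S 1%g x)); apply/hasP; exists 1%g => //.
    by apply/rF; apply: subgroup1.
  have Eg : E (S g x).
    apply/allP => h hr; rewrite gn; apply: nmin; apply/hasP; exists (h * g)%g.
      by apply/rF; apply: subgroupM => //; apply/rF.
    by rewrite actM.
  rewrite (bigD1_seq g) //= Eg big_seq_cond big1 ?addr0 // => h /andP[hr hg].
  case Eh : (E (S h x)) => //; case/eqP: hg.
  have mem a a' : a \in r -> a' \in r -> (a * a'^-1)%g \in r.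
    by move=> /rF Fa /rF Fa'; apply/rF; apply: sF.2.
  have le1 := allP Eg _ (mem _ _ hr gr); have le2 := allP Eh _ (mem _ _ gr hr).
  rewrite -actM mulgVK in le1; rewrite -actM mulgVK in le2.
  apply: divg1_eq; apply: (uF _ (S g x)); first exact/rF/mem.
  by rewrite -actM mulgVK; apply/eqP; rewrite eqn_leq le1 le2.
pose f x : int := (E x)%:R.
have fl : locally_constant f by apply: (locally_constant_comp (fun b : bool => b%:R)).
have : (1 = (size r)%:Z * tau f)%R.
  rewrite -{1}(tau1 C); have -> : (fun _ : X => 1 : int) =
      fun x => \sum_(g <- r) f (S g x) by apply/funext => x; rewrite E1.
  rewrite (additive_sum (tauD C)) => [|g]; last first.
    exact: locally_constant_precomp (@act_cts _ _ S g) fl.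
  rewrite (eq_bigr (fun=> tau f)) => [|g _]; last exact: (tau_inv C).
  by rewrite big_const_seq count_predT iter_addr addr0 -mulr_natl natz.
(* The sign of tau f is unknown, but as an integer it makes |F| a divisor of 1. *)
move=> s1; have : ((size r)%:Z %| 1)%Z by apply/dvdzP; exists (tau f); rewrite mulrC.
rewrite dvdz1 absz_nat => /eqP {}s1 g /rF gr.
have : 1%g \in r by apply/rF; apply: subgroup1.
by case: (r) s1 gr => // x [|] //= _; rewrite !inE => /eqP-> /eqP->.
Qed.

End InvariantFunctional.

Lemma continuous_pairl (D : choiceType) (X : topologicalType) (d : D) :
  continuous (fun x : X => ((d : discrete_topology D), x)).
Proof.
move=> x A [[P Q] /= [Pd Qx] PQ]; rewrite /nbhs /=.
apply: filterS Qx => y Qy; apply: PQ; split=> //=.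
exact: nbhs_singleton Pd.
Qed.

(** * Cocycles of an orbit equivalence *)

Section OrbitEquivalence.
Local Open Scope group_scope.
Context {G H : groupType} {X Y : topologicalType}
  {S : dynsys G X} {T : dynsys H Y}.

(** Both cocycles are based on X, b being pulled back along phi. Thus a(-, x) and b(-, x) are
    mutually inverse bijections for each x. *)
Record orbit_cocycles (phi : X -> Y) (psi : Y -> X)
    (a : G -> X -> H) (b : H -> X -> G) : Prop := {
  oc_phi : continuous phi;
  oc_psi : continuous psi;
  oc_phiK : cancel phi psi;
  oc_psiK : cancel psi phi;
  oc_a : cocycle (S := S) a;
  oc_b : forall h, locally_constant (b h);
  oc_phiS : forall g x, phi (S g x) = T (a g x) (phi x);
  oc_psiT : forall h x, psi (T h (phi x)) = S (b h x) x;
  oc_ba : forall g x, b (a g x) x = g;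
  oc_ab : forall h x, a (b h x) x = h }.

(** Near z both u and v are constant, so (v z)^-1 * u z fixes a nonempty open set pointwise, which
    topological freeness allows for the identity only. *)
Lemma locally_constant_act_inj (K : groupType) (Z : topologicalType)
    (R : dynsys K Z) (u v : Z -> K) : topologically_free R ->
  locally_constant u -> locally_constant v ->
  (forall z, R (u z) z = R (v z) z) -> u =1 v.
Proof.
move=> Rf ul vl uv z; apply: contrapT => uvz.
have /Rf dR : (v z)^-1 * u z <> 1.
  by move=> e; apply: uvz; apply: (mulgI (v z)^-1); rewrite e mulVg.
have near_fix : nbhs z [set y | u y = u z /\ v y = v z].
  exact: filterS2 (ul z) (vl z).
move: near_fix; rewrite nbhsE => -[O [Oo Oz] OP].
have [||y [Oy]] := dR O; [by exists z | by [] |].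
by apply; have [<- <-] := OP y Oy; rewrite actM uv -actM mulVg act1.
Qed.

(** In each identity the two sides move every point in the same way, so they agree by
    [locally_constant_act_inj]. *)
Lemma orbit_equivalence_cocycles : topologically_free S ->
  topologically_free T -> continuously_orbit_equivalent S T ->
  exists phi psi a b, orbit_cocycles phi psi a b.
Proof.
move=> Sf Tf [phi [psi [a [b [[phic psic phiK psiK] ac bc phiS psiT]]]]].
pose a' (g : G) (x : X) : H := a (g, x); pose b0 (h : H) (y : Y) : G := b (h, y).
have al g : locally_constant (a' g).
  apply/continuous_discreteP => x.
  exact: continuous_comp (@continuous_pairl _ _ g x) (ac (g, x)).
have b0l h : locally_constant (b0 h).
  apply/continuous_discreteP => y.
  exact: continuous_comp (@continuous_pairl _ _ h y) (bc (h, y)).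
pose b' h x := b0 h (phi x).
have bl h : locally_constant (b' h) by exact: locally_constant_precomp phic (b0l h).
have inj_T (u v : X -> H) : locally_constant u -> locally_constant v ->
    (forall x, T (u x) (phi x) = T (v x) (phi x)) -> u =1 v.
  move=> ul vl uv x; have := @locally_constant_act_inj H Y T
    (fun y => u (psi y)) (fun y => v (psi y)) Tf.
  move=> /(_ (locally_constant_precomp psic ul) (locally_constant_precomp psic vl)).
  move=> /(_ _ (phi x)); rewrite phiK; apply => y.
  by have := uv (psi y); rewrite psiK.
have psiT' h x : psi (T h (phi x)) = S (b' h x) x by rewrite psiT phiK.
exists phi, psi, a', b'; split=> //.
- split=> // g h; apply: inj_T => [//||x].
    apply: (locally_constant_comp2 (fun y z => y * z)) => //.
    exact: locally_constant_precomp (@act_cts _ _ S h) (al g).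
  by rewrite -phiS !actM -!phiS.
- move=> g; apply: (locally_constant_act_inj Sf) => [||x].
  + exact: (locally_constant_dep (al g)).
  + exact: locally_constant_cst.
  + by rewrite -psiT' -phiS phiK.
- move=> h; apply: inj_T => [||x].
  + exact: (locally_constant_dep (bl h)).
  + exact: locally_constant_cst.
  + by rewrite -phiS -psiT' psiK.
Qed.

Section Cocycles.
Context {phi : X -> Y} {psi : Y -> X} {a : G -> X -> H} {b : H -> X -> G}.
Hypotheses (Xc : compact [set: X]) (O : orbit_cocycles phi psi a b).

Lemma oc_b_mul t g x : b (t * a g x) x = b t (S g x) * g.
Proof.
rewrite -[RHS](oc_ba O _ x); congr (b _ x).
by rewrite (oc_a O).2 (oc_ab O).
Qed.

Lemma oc_a1 x : a 1 x = 1.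
Proof.
by have := (oc_a O).2 1 1 x; rewrite act1 mulg1 => /esym/(canRL (mulgK _)); rewrite mulgV.
Qed.

Lemma oc_b1 x : b 1 x = 1.
Proof. by rewrite -(oc_a1 x) (oc_ba O). Qed.

Lemma left_bounded_a x : left_bounded (fun g => a g x).
Proof.
move=> s; exists (range (a s)); first exact: locally_constant_finite Xc ((oc_a O).1 s).
by move=> g; exists (S g x) => //; rewrite (oc_a O).2 mulgK.
Qed.

Lemma left_bounded_b x : left_bounded (fun h => b h x).
Proof.
move=> s; exists (range (b s)); first exact: locally_constant_finite Xc (oc_b O s).
move=> h; exists (S (b h x) x) => //.
by rewrite -{2}(oc_ab O h x) oc_b_mul mulgK.
Qed.

(** By compactness the generators s of H yield finitely many values b s y. By [oc_b_mul] each b h x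
    is a product of these and their inverses, and b(-, x) is onto G. *)
Lemma finitely_generated_of_orbit_equivalence (x : X) :
  finitely_generated_group H -> finitely_generated_group G.
Proof.
move=> [A AH].
have /finite_seqP[r rP] : finite_set (\bigcup_(s in [set` A]) range (b s)).
  by apply: bigcup_finite => // s _; apply: locally_constant_finite Xc (oc_b O s).
exists r; rewrite -rP; set B := \bigcup_(s in _) _.
have sB := generated_subgroup B.
have Bb s y : s \in A -> generated B (b s y).
  by move=> sA; apply: sub_generated; exists s => //; exists y.
suff bB h : generated B (b h x).
  by apply/seteqP; split=> // g _; rewrite -(oc_ba O g x); apply: bB.
apply: (@generated_ind H [set` A] [set h | generated B (b h x)] 1 AH).
  move=> y s /= By As; split.
    by rewrite -(oc_ab O y x) oc_b_mul; apply: (subgroupM sB) => //; apply: Bb.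
  have : b y x = b s (S (b (s^-1 * y) x) x) * b (s^-1 * y) x.
    by rewrite -oc_b_mul (oc_ab O) mulVKg.
  move=> e; have -> : b (s^-1 * y) x =
      (b s (S (b (s^-1 * y) x) x))^-1 * b y x by rewrite e mulKg.
  by apply: (subgroupM sB) => //; apply: (subgroupV sB); apply: Bb.
by rewrite /= oc_b1; apply: (subgroup1 sB).
Qed.

End Cocycles.
End OrbitEquivalence.

(** * Conjugacy from a trivial cocycle *)

Section Conjugacy.
Local Open Scope group_scope.
Context {G H : groupType} {X Y : topologicalType}
  {S : dynsys G X} {T : dynsys H Y}.
Context {phi : X -> Y} {psi : Y -> X} {a : G -> X -> H} {b : H -> X -> G}.
Context {I : choiceType} {tau : (X -> int) -> int} {c : I -> (X -> int) -> int}
  {e : I -> X -> int}.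
Hypotheses (Xc : compact [set: X]) (O : orbit_cocycles (S := S) (T := T) phi psi a b)
  (C : projective_coordinates S tau c e).

Lemma conjugate_of_trivial_cocycle (u : X -> H) : locally_constant u ->
  (forall g x y, twist (S := S) u a g x = twist (S := S) u a g y) -> conjugate S T.
Proof.
move=> ul utriv; have [x0 _] := coordinates_inhabited C.
have [al aM] := oc_a O.
pose rho g := twist (S := S) u a g x0.
have rhoE g x : rho g = (u (S g x))^-1 * a g x * u x by apply: utriv.
have aE g x : a g x = u (S g x) * rho g * (u x)^-1.
  by rewrite (rhoE g x) !mulgA mulgV mul1g mulgK.
have rhoM : {morph rho : g h / g * h}.
  move=> g h; rewrite (rhoE (g * h) x0) (rhoE g (S h x0)) (rhoE h x0) aM actM.
  by rewrite !mulgA mulgK.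
have rho1 : rho 1 = 1 by apply: (mulgI (rho 1)); rewrite -rhoM !mulg1.
have rhoV g : rho g^-1 = (rho g)^-1.
  by apply: (mulgI (rho g)); rewrite -rhoM !mulgV.
pose phi' x := T (u x)^-1 (phi x).
have phi'S g x : phi' (S g x) = T (rho g) (phi' x).
  by rewrite /phi' (oc_phiS O) -!actM (aE g x) !mulgA mulVg mul1g.
have phiE x : phi x = T (u x) (phi' x) by rewrite /phi' -actM mulgV act1.
have connect h x x' : T h (phi' x) = phi' x' -> exists2 g, rho g = h & x' = S g x.
  move=> hx; pose k := u x' * h * (u x)^-1; pose g := b k x.
  have x'E : x' = S g x.
    rewrite -(oc_phiK O x') -(oc_psiT O) phiE -hx (phiE x) -!actM; congr (psi (T _ _)).
    by rewrite /k mulgVK.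
  exists g => //; rewrite (rhoE g x) -x'E (oc_ab O).
  by rewrite /k !mulgA mulVg mul1g mulgVK.
have rho_ker g : rho g = 1 -> g = 1.
  have sF : is_subgroup [set g | rho g = 1].
    by split=> // g1 g2 /= e1 e2; rewrite rhoM rhoV e1 e2 invg1 mulg1.
  (* If rho g = 1, then a g x0 = u (S g x0) * (u x0)^-1 takes finitely many values, and it
     determines g. *)
  have Ffin : finite_set [set g | rho g = 1].
    apply: sub_finite_set (finite_image (fun v => b (v * (u x0)^-1) x0)
      (locally_constant_finite Xc ul)) => g1 /= e1.
    exists (u (S g1 x0)); first by exists (S g1 x0).
    by rewrite -[RHS](oc_ba O g1 x0) (aE g1 x0) e1 mulg1.
  have [r ur uxr] := range_seq Xc ul.
  (* Numbering the values of u makes them comparable. If rho g1 = 1 and v agrees at x and S g1 x,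
     then a g1 x = 1 and so g1 = 1. *)
  pose v x := index (u x) r.
  have vl : locally_constant v by apply: (locally_constant_comp (index^~ r)).
  apply: (finite_free_subgroup_trivial C sF Ffin vl) => g1 x e1 vx.
  have {}vx : u (S g1 x) = u x.
    by rewrite -[LHS](nth_index 1 (uxr _)) -[RHS](nth_index 1 (uxr _)) -/(v _) vx.
  by rewrite -(oc_ba O g1 x) (aE g1 x) e1 vx mulg1 mulgV (oc_b1 O).
have rho_inj : injective rho.
  move=> g h gh; apply: divg1_eq; apply: rho_ker.
  by rewrite rhoM rhoV gh mulgV.
have phi'_inj : injective phi'.
  move=> x x' xx'; have [|g /rho_ker-> ->] := connect 1 x x'.
    by rewrite act1.
  by rewrite act1.
(* The sets T h (phi' X), with h running through representatives of
   H / rho G, partition Y, and each has tau-measure 1. *)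
pose chi h x := `[< exists z, phi x = T h (phi' z) >].
have tau_chi h : tau (fun x => (chi h x)%:R%R) = 1%R.
  pose k x := b (h * (u x)^-1) x.
  have kE z : psi (T h (phi' z)) = S (k z) z.
    by rewrite /phi' -actM (oc_psiT O).
  have kl : locally_constant k.
    by apply: (locally_constant_dep (F := fun v => b (h * v^-1)) ul) => v; apply: oc_b O _.
  rewrite -[RHS](tau_range_injective Xc C kl) => [|z z']; last first.
    rewrite -!kE => /(can_inj (oc_psiK O)) hz; apply: phi'_inj.
    by rewrite -[LHS](act1 T) -[RHS](act1 T) -(mulVg h) !actM hz.
  congr tau; apply/funext => x.
  suff -> : chi h x = `[< exists z, x = S (k z) z >] by [].
  apply: asbool_equiv_eq; split=> -[z xz]; exists z; first by rewrite -kE -xz (oc_phiK O).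
  by rewrite xz -kE (oc_psiK O).
pose rel h h' := exists g, h' = h * rho g.
pose rep h := xget 1 [set h' | rel h h'].
have rel_sym h h' : rel h h' -> rel h' h.
  by move=> [g ->]; exists g^-1; rewrite rhoV mulgK.
have rel_trans h h' h'' : rel h h' -> rel h' h'' -> rel h h''.
  by move=> [g ->] [g' ->]; exists (g * g'); rewrite rhoM -mulgA.
have repP h : rel h (rep h).
  by apply: (@xgetPex _ 1 [set h' | rel h h']); exists h, 1; rewrite rho1 mulg1.
have rep_eq h h' : rel h h' -> rep h = rep h'.
  move=> hh'; congr xget; apply/seteqP; split=> w /=; last exact: rel_trans.
  by apply: rel_trans; apply: rel_sym.
have chiP h x : chi h x <-> rel (u x) h.
  split=> [/asboolP[z xz]|[g ->]]; last first.
    apply/asboolP; exists (S g^-1 x).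
    by rewrite actM -phi'S -actM mulgV act1 -phiE.
  have [|g gE _] := connect ((u x)^-1 * h) z x.
    by rewrite actM -xz phiE -actM mulVg act1.
  by exists g; rewrite gE mulVKg.
have [r ur uxr] := range_seq Xc ul.
pose J := undup (map rep r).
have repJ x : rep (u x) \in J by rewrite mem_undup map_f.
have JE h : h \in J -> rep h = h.
  by rewrite mem_undup => /mapP[h' _ ->]; apply/rep_eq/rel_sym.
have J1 : size J = 1%N.
  have : (1 = \sum_(h <- J) tau (fun x => (chi h x)%:R))%R.
    rewrite -(additive_sum (tauD C)) => [|h]; last first.
      apply: (locally_constant_comp (fun b : bool => b%:R%R)) => x.
      apply: filterS (ul x) => y /= uy.
      by apply/idP/idP => /chiP hy; apply/chiP; [rewrite -uy | rewrite uy].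
    rewrite -{1}(tau1 C); congr tau; apply/funext => x.
    rewrite (bigD1_seq (rep (u x))) ?undup_uniq //= (iffRL (chiP _ _) (repP _)).
    rewrite big_seq_cond big1 ?addr0 // => h /andP[hJ hr].
    case Eh : (chi h x) => //; case/eqP: hr.
    by rewrite -(JE h hJ); apply/esym/rep_eq/chiP.
  rewrite (eq_bigr (fun=> 1%R)) // big_const_seq count_predT iter_addr addr0.
  by move=> /eqP; rewrite eq_sym pnatr_eq1 => /eqP.
have rep_const x x' : rep (u x) = rep (u x').
  move: (repJ x) (repJ x') J1; case: (J) => [|h []] //=.
  by rewrite !inE => /eqP-> /eqP->.
have u_rel x x' : rel (u x) (u x').
  by apply: (rel_trans _ _ _ (repP _)); rewrite (rep_const x x'); apply: rel_sym.
have rho_surj h : exists g, rho g = h.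
  (* With a g x0 = h1 one gets rho g = (u (S g x0))^-1 * u x0 * h. As all values of u lie in one
     coset of the image of rho, the factor in front of h is rho g1^-1. *)
  pose h1 := u x0 * h * (u x0)^-1; pose g := b h1 x0.
  have [g1 g1E] := u_rel x0 (S g x0).
  exists (g1 * g); rewrite rhoM; apply: (mulgI (u x0)); apply: (mulIg (u x0)^-1).
  by rewrite mulgA -g1E -aE (oc_ab O).
have /choice[rinv rinvK] := rho_surj.
have u_rho x : exists g, rho g = u x by apply: rho_surj.
(* The relation phi x = T (u x) (phi' x) becomes phi x = phi' (S g x) once u x = rho g. *)
pose psi' y := S (rinv (u (psi y))) (psi y).
have psi'K : cancel psi' phi'.
  by move=> y; rewrite /psi' phi'S rinvK -phiE (oc_psiK O).
pose rhoH : {multiplicative G -> H} := HB.pack rho (isMultiplicative.Build G H rho rhoM).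
exists phi', psi', rhoH; split.
- split=> //; last by move=> x; apply: phi'_inj; rewrite psi'K.
    apply: continuous_act_locally_constant; last exact: oc_phi O.
    exact: (locally_constant_comp (fun h => h^-1)).
  apply: continuous_act_locally_constant; last exact: oc_psi O.
  apply: (locally_constant_comp rinv).
  exact: locally_constant_precomp (oc_psi O) ul.
- by exists rinv => [g|h] //=; apply: rho_inj; rewrite rinvK.
- exact: phi'S.
Qed.

End Conjugacy.

Theorem theorem1p4 (G H : groupType) (X Y : topologicalType)
    (S : dynsys G X) (T : dynsys H Y) :
  countable [set: G] -> countable [set: H] ->
  hausdorff_space X -> compact [set: X] ->
  hausdorff_space Y -> locally_compact [set: Y] ->
  duality_group G -> ~ infinite_cyclic G ->
  finitely_generated_group H -> solvable_group H ->
  topologically_free S -> almost_projective S ->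
  topologically_free T ->
  continuously_orbit_equivalent S T -> conjugate S T.
Proof.
move=> _ _ _ Xc _ _ [Gfp [n [Gcoh _]]] Gnc Hfg Hsol Sf Sproj Tf ST.
have [I [tau [c [e C]]]] := almost_projective_coordinates Sproj.
have [x0 _] := coordinates_inhabited C.
have [phi [psi [a [b O]]]] := orbit_equivalence_cocycles Sf Tf ST.
have Gfg := finitely_generated_of_orbit_equivalence Xc O x0 Hfg.
have Goe : one_ended G.
  have [n1|/Gcoh] := pselect (1%N = n); last exact: one_ended_of_cohomology.
  apply: contrapT => Gnoe; apply: Gnc.
  apply: (infinite_cyclic_of_bounded_bijection _ _ (left_bounded_a Xc O x0)
    (left_bounded_b Xc O x0) Hfg Hsol Gfg (torsion_free_of_type_FP Gfp) Gnoe).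
  - by move=> g; apply: oc_ba O _ _.
  - by move=> h; apply: oc_ab O _ _.
have [u [ul uP]] := cocycle_trivial Gfg Goe Xc C x0 Hsol (oc_a O).
exact: (conjugate_of_trivial_cocycle Xc O C ul uP).
Qed.
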